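(* Fix a prime power $q$ and an integer $t\ge2$ (so $d=2t+1\ge5$), and assume $n\ge 5t+3$. Let $V=\mathbb F_q^n$ and let $\star\in\{A,B\}$. Let $\mathcal F$ be a family of subspaces of $V$ with $\mathrm{diam}(\mathcal F)\le 2t+1$ such that: if $\star=A$, $\mathcal F\not\subseteq\mathcal D_t(X)$ and $\mathcal F\not\subseteq\mathcal D_t(X)^\perp$ for every $1$-dimensional subspace $X$; if $\star=B$, $\mathcal F\not\subseteq\mathcal B(X,t)\cup\mathcal B(Y,t)$ for all subspaces $X,Y$ with $\Delta(X,Y)=1$. Then \[ |\mathcal F|\le\sum_{i=0}^{t}\begin{bmatrix} n\\ i\end{bmatrix}_q+\begin{bmatrix} n-1\\ t\end{bmatrix}_q-q^{t(t+1)}\begin{bmatrix} n-t-2\\ t\end{bmatrix}_q+q^{t+1}. \] Moreover, equality holds if and only if one of the following occurs: (1) there exist $X\in\mathcal V(1)$ and $Y\in\mathcal V(t+1)$ with $X\not\le Y$ such that $\mathcal F=\mathcal K(n,t+1,X,Y)$ or $\mathcal F^\perp=\mathcal K(n,t+1,X,Y)$; (2) $t=2$, and there exists $Y\in\mathcal V(3)$ such that $\mathcal F=\mathcal K^*(n,3,Y)$ or $\mathcal F^\perp=\mathcal K^*(n,3,Y)$.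
   Context: $V=\mathbb F_q^n$; $\mathcal V$ is the set of all subspaces of $V$, $\mathcal V(k)$ the set of $k$-dimensional subspaces, $\boldsymbol 0$ the zero subspace; $\begin{bmatrix} n\\ k\end{bmatrix}_q=|\mathcal V(k)|=\prod_{i=0}^{k-1}\frac{q^{n-i}-1}{q^{k-i}-1}$. $U\le W$ means $U$ is a subspace of $W$. $\Delta(U,W)=\dim(U+W)-\dim(U\cap W)$; $\mathrm{diam}(\mathcal F)=\max\{\Delta(U,W):U,W\in\mathcal F\}$. $\mathcal B(C,r)=\{A\in\mathcal V:\Delta(A,C)\le r\}$. $U^\perp$ is the orthogonal complement w.r.t. a fixed nondegenerate bilinear form, $\mathcal F^\perp=\{U^\perp:U\in\mathcal F\}$. For $X\in\mathcal V(1)$, $\mathcal D_t(X)=\bigcup_{k=0}^{t}\mathcal V(k)\cup\{A\in\mathcal V(t+1):X\le A\}$ (which equals $\mathcal B(\boldsymbol0,t)\cup\mathcal B(X,t)$). For $X\in\mathcal V(1)$, $Y\in\mathcal V(k)$ with $X\not\le Y$: $\mathcal{HM}(n,k,X,Y)=\{A\in\mathcal V(k):X\le A,\ \dim(A\cap Y)\ge1\}\cup\{A\in\mathcal V(k):A\le X+Y\}$ and $\mathcal K(n,k,X,Y)=\bigcup_{i=0}^{k-1}\mathcal V(i)\cup\mathcal{HM}(n,k,X,Y)$. For $Y\in\mathcal V(3)$: $\mathcal{HM}^*(n,3,Y)=\{A\in\mathcal V(3):\dim(A\cap Y)\ge2\}$ and $\mathcal K^*(n,3,Y)=\bigcup_{i=0}^{2}\mathcal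 V(i)\cup\mathcal{HM}^*(n,3,Y)$. *)

(* Defs.v *)
From HB Require Import structures.
From mathcomp Require Import all_boot all_order all_algebra.

Set Implicit Arguments.
Unset Strict Implicit.
Unset Printing Implicit Defensive.

Import Order.TTheory GRing.Theory Num.Theory.
Local Open Scope ring_scope.

Import VectorInternalTheory.

HB.instance Definition _ (F : finFieldType) (vT : vectType F) :=
  [Countable of {vspace vT} by <:].
HB.instance Definition _ (F : finFieldType) (vT : vectType F) :=
  [Finite of {vspace vT} by <:].

Definition gauss_binom (q n k : nat) : rat :=
  \prod_(i < k) ((q%:R ^+ (n - i) - 1) / (q%:R ^+ (k - i) - 1)).

Inductive variant := VariantA | VariantB.

Section Subspaces.

Variables (F : finFieldType) (n : nat).
Local Notation V := 'rV[F]_n.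
Implicit Types (A C U W X Y : {vspace V}) (Fam : {set {vspace V}}).

Definition grassmannian (k : nat) : {set {vspace V}} :=
  [set U : {vspace V} | \dim U == k].

Definition subspace_dist U W : nat := (\dim (U + W) - \dim (U :&: W))%N.

Definition diam Fam : nat :=
  (\max_(U in Fam) \max_(W in Fam) subspace_dist U W)%N.

Definition ball C (r : nat) : {set {vspace V}} :=
  [set A : {vspace V} | (subspace_dist A C <= r)%N].

Definition nondegenerate_form (form : {biscalar V}) : Prop :=
  (forall u, (forall v, form u v = 0) -> u = 0) /\
  (forall v, (forall u, form u v = 0) -> v = 0).

(* The vectors v below already form a subspace (see mem_perp), so the span only
   packages them as a {vspace V}. The form need not be symmetric. *)
Definition perp (form : {biscalar V}) U : {vspace V} :=
  <<enum [set v : V | [forall u : V, (u \in U) ==> (form u v == 0)%R]]>>%VS.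

Lemma mem_perp (form : {biscalar V}) U v :
  reflect (forall u, u \in U -> form u v = 0) (v \in perp form U).
Proof.
apply: (iffP idP) => [vU u uU|Uv].
  rewrite /perp in vU; set s := enum _ in vU.
  have su x : x \in s -> form u x = 0.
    by rewrite mem_enum inE => /forallP/(_ u)/implyP/(_ uU)/eqP.
  rewrite (coord_span (X := in_tuple s) vU) linear_sumr big1 // => i _.
  by rewrite linearZr_LR /= su ?mulr0 ?mem_nth.
apply: memv_span; rewrite mem_enum inE.
by apply/forallP => u; apply/implyP => uU; apply/eqP/Uv.
Qed.

Definition perp_family (form : {biscalar V}) Fam : {set {vspace V}} :=
  [set perp form U | U in Fam].

Definition D_family (t : nat) X : {set {vspace V}} :=
  (\bigcup_(k < t.+1) grassmannian k)
  :|: [set A in grassmannian t.+1 | (X <= A)%VS].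

Definition HM_family (k : nat) X Y : {set {vspace V}} :=
  [set A in grassmannian k | (X <= A)%VS & (1 <= \dim (A :&: Y))%N]
  :|: [set A in grassmannian k | (A <= X + Y)%VS].

Definition K_family (k : nat) X Y : {set {vspace V}} :=
  (\bigcup_(i < k) grassmannian i) :|: HM_family k X Y.

Definition HMstar_family Y : {set {vspace V}} :=
  [set A in grassmannian 3 | (2 <= \dim (A :&: Y))%N].

Definition Kstar_family Y : {set {vspace V}} :=
  (\bigcup_(i < 3) grassmannian i) :|: HMstar_family Y.

End Subspaces.

Definition stability_bound (q n t : nat) : rat :=
  (\sum_(i < t.+1) gauss_binom q n i) + gauss_binom q (n - 1) t
  - q%:R ^+ (t * (t + 1)) * gauss_binom q (n - t - 2) t + q%:R ^+ (t + 1).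

(* Main.v *)
(** Let [g m k] be the Gaussian binomial coefficient. If all members have dimension at
    most t+1, then those of dimension t+1 form an intersecting family without a common
    point, and the bound and its equality cases are the Hilton-Milner theorem for vector
    spaces. That theorem is proved by looking at the 2-spaces meeting every member: in a
    maximal intersecting family these pairwise meet, so they share a point or lie in a
    common 3-space, and every 2-space that is not of this kind is contained in few members.

    Otherwise, up to duality, the family has a member of dimension at least t+2 while its
    extreme dimensions add up to at most n, and the bound is strict. Indeed, two members
    A, A' of dimension i satisfy dim (A :&: A') >= i - t, and counting the members of
    dimension i according to their intersection with a fixed A :&: A' of minimal dimension
    bounds their number by about [q^-(t(i-t)) g n t]; the t-dimensional members all
    meet a fixed small subspace. All together the members of dimension at least t are
    fewer than [g n t]. *)

From HB Require Import structures.
Require Import Defs.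
From mathcomp Require Import all_boot all_order all_algebra all_field.
From mathcomp Require Import zify ring lra.

Set Implicit Arguments.
Unset Strict Implicit.
Unset Printing Implicit Defensive.

Import Order.TTheory GRing.Theory Num.Theory.
Local Open Scope ring_scope.

(** The hypothesis [5 * t + 3 <= n] is exactly what three comparisons of exponents require: the
    ratio of [n-2,t-1] to [n-3,t-2] must reach q^(4t+2) in the Hilton-Milner estimates, the layer j
    = 1 of the (t+1)-dimensional members must lose enough powers of q, and the t-spaces meeting a
    space of dimension up to 3t+1 must be at most a fraction q^-(t+2) of [n,t]. The case of large
    dimensions has little numerical room. The diameter leaves up to 2t+2 dimensions above t, and for
    q = t = 2 the bounds on the fractions of [n,t] add up to 31/32. This forces explicit constants,
    and error terms weighted by 2^-j whose sum is 1 - 2^-t rather than 1. Two spaces of equal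
    dimension are at even distance, so inside one dimension the odd bound 2t+1 acts as 2t. Duality
    enters because the count at dimension i is made for 2i <= n; the form need not be symmetric, so
    [perp] serves as a lattice anti-automorphism and never as an involution. *)

Ltac nat_lia :=
  repeat match goal with
  | H : ?P |- _ => lazymatch P with
      | is_true (leq _ _) => revert H
      | @eq nat _ _ => revert H
      end
  end; clear; lia.

(** * Gaussian binomial coefficients *)

(** Inductive step of [gb_le4], with r = q, a = q^(k+1) and y = q^(m-k-1). *)
Lemma gb_le4_step (r a y : rat) : 2 <= r -> 2 <= a -> 1 <= y ->
  (r * a * y - 1) / (r * a - 1) * (1 + 2 / (r * a)) <= (1 + 2 / a) * y.
Proof.
move=> hr ha hy.
have ra : 4 <= r * a by nra.
rewrite mulrAC ler_pdivrMr; last by lra.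
have -> : 1 + 2 / (r * a) = (r * a + 2) / (r * a) by field; nra.
have -> : 1 + 2 / a = (a + 2) / a by field; lra.
rewrite mulrA ler_pdivrMr; last by lra.
have -> : (a + 2) / a * y * (r * a - 1) * (r * a) = (a + 2) * y * (r * a - 1) * r.
  by field; lra.
apply: (le_trans (y := (r * y) * ((r * a + 2) * a))); first by nra.
have -> : (a + 2) * y * (r * a - 1) * r = (r * y) * ((a + 2) * (r * a - 1)) by ring.
rewrite ler_wpM2l //; first by nra.
suff : 0 <= 2 * r * a - 3 * a - 2 by nra.
by nra.
Qed.

Section GaussBinom.
Variable q : nat.
Hypothesis q_gt1 : (1 < q)%N.
Local Notation Q := (q%:R : rat).
Local Notation gb := (gauss_binom q).

Lemma ge2q : 2 <= Q. Proof. by rewrite ler_nat. Qed.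
Lemma q_gt0 : 0 < Q. Proof. by rewrite ltr0n; lia. Qed.
Lemma expq_gt0 m : 0 < Q ^+ m. Proof. by rewrite exprn_gt0 // q_gt0. Qed.
Lemma expq_ge1 m : 1 <= Q ^+ m. Proof. by rewrite exprn_ege1 // ler1n; lia. Qed.
Lemma expq_gt1 m : (0 < m)%N -> 1 < Q ^+ m.
Proof. by case: m => // m _; rewrite exprn_egt1 // ltr1n. Qed.
Lemma expqB1_gt0 m : 0 < Q ^+ m.+1 - 1.
Proof. by rewrite subr_gt0 expq_gt1. Qed.
Lemma leq_expq i j : (i <= j)%N -> Q ^+ i <= Q ^+ j.
Proof. by move=> ij; rewrite ler_eXn2l // ltr1n. Qed.

Lemma gb0 m : gb m 0 = 1. Proof. by rewrite /gauss_binom big_ord0. Qed.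

Lemma gbSS m k :
  gb m.+1 k.+1 = (Q ^+ m.+1 - 1) / (Q ^+ k.+1 - 1) * gb m k.
Proof. by rewrite /gauss_binom big_ord_recl /= !subn0; congr (_ * _). Qed.

Lemma gb0S k : gb 0 k.+1 = 0.
Proof. by rewrite /gauss_binom big_ord_recl /= sub0n expr0 subrr !mul0r. Qed.

Lemma gb_ge0 m k : 0 <= gb m k.
Proof.
elim: k m => [|k IHk] [|m]; rewrite ?gb0 ?gb0S //.
by rewrite gbSS mulr_ge0 ?IHk // divr_ge0 // ltW // expqB1_gt0.
Qed.

Lemma gb_gt0 m k : (k <= m)%N -> 0 < gb m k.
Proof.
elim: k m => [|k IHk] [|m] //; rewrite ?gb0 // ltnS => km.
by rewrite gbSS mulr_gt0 ?IHk // divr_gt0 ?expqB1_gt0.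
Qed.

Lemma gbnn m : gb m m = 1.
Proof.
elim: m => [|m IHm]; first exact: gb0.
by rewrite gbSS IHm mulr1 divff // gt_eqF // expqB1_gt0.
Qed.

Lemma gb1 m : gb m 1 = (Q ^+ m - 1) / (Q - 1).
Proof.
case: m => [|m]; first by rewrite gb0S expr0 subrr mul0r.
by rewrite gbSS gb0 mulr1.
Qed.

Lemma gb_pred m : gb m.+1 m = gb m.+1 1.
Proof.
rewrite gb1; elim: m => [|m IHm].
  by rewrite gb0 divff // gt_eqF // (expqB1_gt0 0).
have h1 := expqB1_gt0 m; have h2 := expqB1_gt0 0; rewrite expr1 in h2.
rewrite gbSS IHm; field.
by rewrite !gt_eqF.
Qed.

Lemma gb1S m : gb m.+1 1 = gb m 1 + Q ^+ m.
Proof.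
have h := expqB1_gt0 0; rewrite expr1 in h.
by rewrite !gb1 exprS; field; rewrite gt_eqF.
Qed.

Lemma gb1_le m : gb m 1 <= Q ^+ m.
Proof.
have h := ge2q; have h' := expq_ge1 m.
rewrite gb1 ler_pdivrMr; last by lra.
by nra.
Qed.

Lemma gb1_le2 m : gb m.+1 1 <= 2 * Q ^+ m.
Proof.
have h := ge2q; have h' := expq_ge1 m.
rewrite gb1 ler_pdivrMr; last by lra.
by rewrite exprS; nra.
Qed.

(* Each quotient (q^(m+1)-1)/(q^(k+1)-1) is at most q^(m-k)/(1-q^-(k+1)), and
   the product of the factors 1-q^-i stays above 1/4 since q >= 2. *)
Lemma gb_le4 m k : (k <= m)%N -> gb m k <= 4 * Q ^+ (k * (m - k)).
Proof.
case: k => [|k] km; first by rewrite gb0 mul0n expr0; lra.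
(* The extra factor makes the induction work: it shrinks as k grows, and the loss absorbs the excess
   1/(1 - q^-(k+2)) of the next quotient. *)
suff: gb m k.+1 * (1 + 2 * Q ^- k.+1) <= 4 * Q ^+ (k.+1 * (m - k.+1)).
  apply: le_trans; rewrite ler_peMr ?gb_ge0 // lerDl.
  by rewrite mulr_ge0 // invr_ge0 ltW ?expq_gt0.
elim: k m km => [|k IHk] [|m] // km.
  rewrite gb1 expr1 mul1n subn1 /= exprS.
  have h := ge2q; have h' := expq_ge1 m.
  have -> : (Q * Q ^+ m - 1) / (Q - 1) * (1 + 2 / Q)
      = (Q * Q ^+ m - 1) * (Q + 2) / (Q * (Q - 1)) by field; lra.
  rewrite ler_pdivrMr; last by nra.
  have : 0 <= Q ^+ m * Q * (3 * Q - 6) by rewrite !mulr_ge0 //; lra.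
  by nra.
have {}IHk := IHk m km.
rewrite gbSS.
have e : (k.+2 * (m.+1 - k.+2) = k.+1 * (m - k.+1) + (m - k.+1))%N by lia.
rewrite e exprD; set y := Q ^+ (m - _) in IHk *; set z := Q ^+ (_ * _) in IHk *.
set g := gb m k.+1 in IHk *.
have -> : Q ^+ m.+1 = Q ^+ k.+2 * y.
  by rewrite /y -exprD; congr (_ ^+ _); lia.
have g0 : 0 <= g by exact: gb_ge0.
rewrite !exprS in IHk *; set x := Q ^+ k in IHk *.
have x1 : 1 <= x by exact: expq_ge1.
have y1 : 1 <= y by exact: expq_ge1.
have z0 : 0 < z by exact: expq_gt0.
have hq := ge2q; move: q_gt0 => q0.
suff H : (Q * (Q * x) * y - 1) / (Q * (Q * x) - 1) * (1 + 2 / (Q * (Q * x)))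
    <= (1 + 2 / (Q * x)) * y.
  rewrite mulrAC [leLHS]mulrC.
  apply: (le_trans (y := g * ((1 + 2 / (Q * x)) * y))); first by rewrite ler_wpM2l.
  by rewrite !mulrA ler_wpM2r //; lra.
by apply: gb_le4_step => //; nra.
Qed.

End GaussBinom.

(** * Counting subspaces *)

Lemma card_bigcup_le (I T : finType) (D : {set I}) (f : I -> {set T}) (c : rat) :
  (forall x, x \in D -> #|f x|%:R <= c) ->
  #|\bigcup_(x in D) f x|%:R <= #|D|%:R * c.
Proof.
move=> fc; apply: (le_trans (y := (\sum_(x in D) #|f x|)%:R)).
  rewrite ler_nat; elim/big_rec2: _ => [|x m C _ IH]; first by rewrite cards0.
  by apply: leq_trans (leq_card_setU _ _).1 _; rewrite leq_add2l.
by rewrite natr_sum mulr_natl -sumr_const; apply: ler_sum.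
Qed.

Section Counting.
Variables (F : finFieldType) (n : nat).
Local Notation V := 'rV[F]_n.
Implicit Types (A B P U W X Y L T : {vspace V}) (G S : {set {vspace V}}) (v : V).
Local Notation q := #|F|.
Local Notation Q := (#|F|%:R : rat).
Local Notation gb := (gauss_binom #|F|).
Let q1 : (1 < #|F|)%N := finNzRing_gt1 F.

Lemma dim_full : \dim (fullv : {vspace V}) = n.
Proof. by rewrite dimvf; exact: mul1n. Qed.

Lemma dim_le U : (\dim U <= n)%N.
Proof. by rewrite -[X in (_ <= X)%N]dim_full dimvS ?subvf. Qed.

Lemma cap_line U v : v \notin U -> (U :&: <[v]> = 0)%VS.
Proof.
move=> vU; apply/eqP; rewrite -subv0; apply/subvP => w.
rewrite memv_cap memv0 => /andP[wU /vlineP[c wE]]; rewrite wE in wU *.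
have [->|c0] := eqVneq c 0; first by rewrite scale0r.
by move: vU; rewrite -[v](scalerK c0) memvZ.
Qed.

Lemma dim_add_line U v : v \notin U -> \dim (U + <[v]>) = (\dim U).+1.
Proof.
move=> vU; rewrite dimv_disjoint_sum ?cap_line // dim_vline.
have -> : v != 0 by apply: contraNneq vU => ->; exact: mem0v.
by rewrite addn1.
Qed.

Lemma double_count S (D : {set V}) :
  (\sum_(B in S) #|[set v in D | v \in B]| =
   \sum_(v in D) #|[set B in S | v \in B]|)%N.
Proof.
under eq_bigr do rewrite -sum1_card.
under [RHS]eq_bigr do rewrite -sum1_card.
rewrite (exchange_big_dep (mem D)) /=; last first.
  by move=> B v _; rewrite inE => /andP[].
apply: eq_bigr => v vD; apply: eq_bigl => B.
by rewrite !inE vD.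
Qed.

Lemma card_vspace_diff U W : (U <= W)%VS ->
  #|[set v | (v \in W) && (v \notin U)]|%:R = Q ^+ \dim W - Q ^+ \dim U.
Proof.
move=> UW.
have e : [set v in W] = [set v in U] :|: [set v | (v \in W) && (v \notin U)].
  apply/setP => v; rewrite !inE.
  by case vU: (v \in U) => /=; [rewrite (subvP UW)|rewrite andbT].
have := congr1 (fun D : {set V} => #|D|) e.
rewrite cardsU disjoint_setI0; last first.
  by rewrite disjoints_subset; apply/subsetP => v; rewrite !inE => ->; rewrite andbF.
rewrite cards0 subn0 !cardsE !card_vspace => E.
by rewrite -!natrX E natrD addrAC subrr add0r.
Qed.

(** For P <= Y the third condition says B :&: Y = P. All later counts specialise this one: Y = P
    gives the spaces through P, and P = Y = 0 the subspaces of W. *)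
Definition ext_set P Y W k : {set {vspace V}} :=
  [set B : {vspace V} | [&& (P <= B)%VS, (B <= W)%VS, (B :&: Y <= P)%VS
                          & \dim B == (\dim P + k)%N]].

(** Induction on k, counting pairs (B, v) with v in B outside Y. For fixed B these v are the vectors
    of B outside P; for fixed v the spaces B form [ext_set (P + <[v]>) (Y + <[v]>) W k]. *)
Lemma card_ext_set P Y W k : (P <= Y)%VS -> (Y <= W)%VS ->
  #|ext_set P Y W k|%:R
  = Q ^+ (k * (\dim Y - \dim P)) * gb (\dim W - \dim Y) k.
Proof.
elim: k P Y => [|k IHk] P Y PY YW.
  rewrite mul0n expr0 gb0 mulr1.
  suff -> : ext_set P Y W 0 = [set P] by rewrite cards1.
  apply/setP => B; rewrite !inE addn0; apply/and4P/eqP => [[PB _ _ /eqP dB]|->].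
    by apply/eqP; rewrite eq_sym eqEdim PB dB /=.
  by rewrite subvv capvSl (subv_trans PY YW).
have [e|ltYW] : \dim Y = \dim W \/ (\dim Y < \dim W)%N.
  by move: (dimvS YW); rewrite leq_eqVlt => /predU1P.
  rewrite e subnn gb0S mulr0.
  suff -> : ext_set P Y W k.+1 = set0 by rewrite cards0.
  have <- : Y = W by apply/eqP; rewrite eqEdim YW e /=.
  apply/setP => B; rewrite !inE; apply/and4P => -[PB BY BYP /eqP dB].
  have : (B <= P)%VS by rewrite -[B in (B <= _)%VS](capv_idPl BY).
  by move/dimvS; rewrite dB; lia.
have H := double_count (ext_set P Y W k.+1) [set v | (v \in W) && (v \notin Y)].
have {H} : (#|ext_set P Y W k.+1|%:R * (Q ^+ (\dim P + k.+1) - Q ^+ \dim P)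
   = (Q ^+ \dim W - Q ^+ \dim Y) *
     (Q ^+ (k * (\dim Y - \dim P)) * gb (\dim W - \dim Y).-1 k)).
  move/(congr1 (fun m : nat => m%:R : rat)): H; rewrite !natr_sum => H.
  transitivity (\sum_(B in ext_set P Y W k.+1)
     #|[set v in [set v0 | (v0 \in W) && (v0 \notin Y)] | v \in B]|%:R : rat).
    rewrite mulr_natl -sumr_const; apply: eq_bigr => B.
    rewrite inE => /and4P[PB BW BYP /eqP dB].
    rewrite -dB -card_vspace_diff //; congr (_%:R); apply: eq_card => v.
    rewrite !inE; case vB: (v \in B); rewrite ?andbF //= (subvP BW) //= andbT.
    congr (~~ _).
    apply/idP/idP => [vP|vY]; first by rewrite (subvP PY).
    by apply: (subvP BYP); rewrite memv_cap vB.
  rewrite {}H -card_vspace_diff // [RHS]mulr_natl -sumr_const; apply: eq_bigr => v.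
  rewrite inE => /andP[vW vY].
  have vP : v \notin P by apply: contraNN vY; apply: (subvP PY).
  rewrite -[_.-1]/((_ - _)%N.-1).
  have -> : ((\dim W - \dim Y).-1 = \dim W - \dim (Y + <[v]>))%N.
    by rewrite dim_add_line //; lia.
  have -> : (\dim Y - \dim P = \dim (Y + <[v]>) - \dim (P + <[v]>))%N.
    by rewrite !dim_add_line.
  rewrite -IHk; first last.
  - by rewrite subv_add YW -memvE.
  - by rewrite addvS.
  congr (_%:R); apply: eq_card => B; rewrite !inE dim_add_line // addSnnS subv_add -memvE.
  (* For v in B the modular law gives B :&: (Y + <[v]>) = (B :&: Y) + <[v]>. Conversely, a vector p
     + c v of Y with p in P has c = 0 because v is outside Y. *)
  apply/idP/idP => [/andP[/and4P[-> -> BYP ->] vB]|]; last first.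
    move=> /and4P[/andP[PB vB] BW BYP dB]; rewrite PB BW dB vB !andbT /=.
    apply/subvP => u uBY.
    have : u \in (P + <[v]>)%VS.
      by apply: (subvP BYP); rewrite (subvP _ _ uBY) // capvS // addvSl.
    case/memv_addP => p pP [w /vlineP[c ->]] e.
    move: uBY; rewrite memv_cap => /andP[uB uY].
    have [c0|c0] := eqVneq c 0; first by rewrite e c0 scale0r addr0.
    case/negP: vY.
    suff -> : v = c^-1 *: (u - p) by rewrite memvZ // memvB // (subvP PY).
    by rewrite e addrAC subrr add0r scalerA mulVf // scale1r.
  rewrite vB /= andbT -vspace_modr; last by rewrite -memvE.
  by rewrite addvS.
set N := #|_|%:R; move=> H.
have h0 := expq_gt0 q1 (\dim P); have h1 := expqB1_gt0 q1 k.
have {}H : N * (Q ^+ \dim P * (Q ^+ k.+1 - 1)) =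
  Q ^+ \dim P * (Q ^+ (\dim Y - \dim P) * (Q ^+ (\dim W - \dim Y) - 1)) *
  (Q ^+ (k * (\dim Y - \dim P)) * gb (\dim W - \dim Y).-1 k).
  rewrite mulrBr mulr1 -exprD H; congr (_ * _).
  have dPY := dimvS PY.
  have -> : Q ^+ \dim W
      = Q ^+ \dim P * Q ^+ (\dim Y - \dim P) * Q ^+ (\dim W - \dim Y).
    by rewrite -!exprD; congr (_ ^+ _); lia.
  have -> : Q ^+ \dim Y = Q ^+ \dim P * Q ^+ (\dim Y - \dim P).
    by rewrite -!exprD; congr (_ ^+ _); lia.
  by ring.
have -> : (\dim W - \dim Y = (\dim W - \dim Y).-1.+1)%N by lia.
rewrite gbSS mulSn exprD; move: H.
have -> : (\dim W - \dim Y = (\dim W - \dim Y).-1.+1)%N by lia.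
rewrite /= => H.
apply: (mulIf (x := Q ^+ \dim P * (Q ^+ k.+1 - 1))).
  by rewrite mulf_neq0 // gt_eqF.
by rewrite {}H; field; rewrite gt_eqF.
Qed.

Lemma card_sup P k : (\dim P <= k)%N ->
  #|[set B | (P <= B)%VS && (\dim B == k)]|%:R = gb (n - \dim P) (k - \dim P).
Proof.
move=> Pk; have := card_ext_set (k - \dim P) (subvv P) (subvf P).
rewrite subnn muln0 expr0 mul1r dim_full => <-.
congr (_%:R); apply: eq_card => B.
by rewrite !inE subvf capvSr subnKC.
Qed.

Lemma card_grassmannian k : #|grassmannian F n k|%:R = gb n k.
Proof.
have := @card_sup 0%VS k; rewrite dimv0 !subn0 => <- //.
by congr (_%:R); apply: eq_card => B; rewrite !inE sub0v.
Qed.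

Lemma card_subspaces W k :
  #|[set B | (B <= W)%VS && (\dim B == k)]|%:R = gb (\dim W) k.
Proof.
have := card_ext_set k (subvv 0) (sub0v W).
rewrite dimv0 subnn muln0 expr0 mul1r subn0 => <-.
by congr (_%:R); apply: eq_card => B; rewrite !inE sub0v capvSr dimv0 add0n.
Qed.

Lemma exists_dim W k : (k <= \dim W)%N -> exists2 B, (B <= W)%VS & \dim B = k.
Proof.
move=> kW; have := gb_gt0 q1 kW.
rewrite -card_subspaces ltr0n => /card_gt0P[B]; rewrite inE => /andP[BW /eqP dB].
by exists B.
Qed.

Lemma cap_neq0P A B : reflect (exists2 v, v != 0 & (v \in A) && (v \in B))
  ((A :&: B)%VS != 0%VS).
Proof.
apply: (iffP idP) => [|[v v0 vAB]].
  rewrite -subv0 => /subvPn[v]; rewrite memv_cap memv0 => vAB v0.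
  by exists v.
by rewrite -subv0; apply/subvPn; exists v; rewrite ?memv_cap ?memv0.
Qed.

Definition star_at G v : {set {vspace V}} := [set B in G | v \in B].

(** Nonzero vectors stand in for points: each member shares at least q - 1 of them with A. The sum
    is kept because stars at different points of A may have different bounds. *)
Lemma cover_bound G A : (forall B, B \in G -> (B :&: A)%VS != 0%VS) ->
  #|G|%:R * (Q - 1) <= \sum_(v in [set v | (v \in A) && (v != 0)]) #|star_at G v|%:R.
Proof.
move=> GA; have := double_count G [set v | (v \in A) && (v != 0)].
move/(congr1 (fun m : nat => m%:R : rat)); rewrite !natr_sum => <-.
rewrite mulr_natl -sumr_const; apply: ler_sum => B BG.
have : (\dim (B :&: A)%VS > 0)%N by rewrite lt0n dimv_eq0 GA.
move=> d0; apply: (le_trans (y := Q ^+ \dim (B :&: A) - Q ^+ \dim (0%VS : {vspace V}))).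
  by rewrite dimv0 expr0 lerB // -[leLHS]expr1 leq_expq.
rewrite -card_vspace_diff ?sub0v // ler_nat subset_leq_card //.
by apply/subsetP => v; rewrite !inE memv_cap memv0 => /andP[/andP[-> ->] ->].
Qed.

Lemma card_nonzero A : #|[set v | (v \in A) && (v != 0)]|%:R = Q ^+ \dim A - 1.
Proof.
have := card_vspace_diff (sub0v A); rewrite dimv0 expr0 => <-.
by congr (_%:R); apply: eq_card => v; rewrite !inE memv0.
Qed.

(** The branching tool: if all members meet A, one more point can be fixed at the price of a factor
    [dim A, 1]. *)
Lemma cover_bound_const G A (c : rat) :
  (forall B, B \in G -> (B :&: A)%VS != 0%VS) ->
  (forall v, v \in A -> v != 0 -> #|star_at G v|%:R <= c) ->
  #|G|%:R <= gb (\dim A) 1 * c.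
Proof.
move=> GA Gc; have hq := ge2q q1.
rewrite gb1 mulrAC ler_pdivlMr; last by lra.
apply: le_trans (cover_bound GA) _.
rewrite -card_nonzero mulr_natl -sumr_const.
by apply: ler_sum => v; rewrite inE => /andP[vA v0]; apply: Gc.
Qed.

End Counting.

(** * The Hilton-Milner families *)

Definition hm_bound (q n t : nat) : rat :=
  gauss_binom q (n - 1) t - q%:R ^+ (t * (t + 1)) * gauss_binom q (n - t - 2) t
  + q%:R ^+ (t + 1).

(** On the left, the 3-space Y itself and, for each of its [3,2] subspaces L of dimension 2, the
    3-spaces meeting Y exactly in L. On the right, [hm_bound] for t = 2 and n = m + 4. This is why
    there are two extremal families when t = 2. *)
Lemma HMstar_identity (q m : nat) : (1 < q)%N ->
  1%:R + gauss_binom q 3 2 * (q%:R * gauss_binom q m.+1 1) =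
  gauss_binom q m.+3 2 - q%:R ^+ (2 * (2 + 1)) * gauss_binom q m 2
  + q%:R ^+ (2 + 1).
Proof.
move=> q1; have hq := ge2q q1; set Q : rat := q%:R in hq *.
have q2 : 4 <= Q * Q by nra.
(* Writing q^(m-1) as q^m / q keeps the closed form valid for m = 0 and m = 1, where [m,2] = 0. *)
have -> : gauss_binom q m 2
    = (Q ^+ m - 1) * (Q ^+ m / Q - 1) / ((Q ^+ 2 - 1) * (Q - 1)).
  case: m => [|[|m]].
  - by rewrite gb0S expr0 subrr !mul0r.
  - by rewrite gbSS gb0S expr1 divff ?subrr ?mulr0 ?mul0r //; lra.
  rewrite !gbSS gb0 mulr1 -/Q !exprS; field.
  by repeat (apply/andP; split); lra.
rewrite !gbSS !gb0 !mulr1 -/Q !exprS expr0; set x := Q ^+ m.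
by field; repeat (apply/andP; split); lra.
Qed.

Section HMFamilies.
Variables (F : finFieldType) (n : nat).
Local Notation V := 'rV[F]_n.
Implicit Types (A B P U W X Y L T : {vspace V}) (G S : {set {vspace V}}) (e u v : V).
Local Notation Q := (#|F|%:R : rat).
Local Notation gb := (gauss_binom #|F|).
Let q1 : (1 < #|F|)%N := finNzRing_gt1 F.

Lemma vline_of_dim1 X : \dim X = 1%N -> exists2 e : V, e != 0 & X = <[e]>%VS.
Proof.
move=> dX; exists (vpick X); first by rewrite vpick0 -dimv_eq0 dX.
apply/eqP; rewrite eq_sym eqEdim -memvE memv_pick dX dim_vline vpick0.
by rewrite -dimv_eq0 dX.
Qed.

Lemma dim_line2 u v : v != 0 -> u \notin <[v]>%VS -> \dim (<[v]> + <[u]>) = 2%N.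
Proof. by move=> v0 uv; rewrite dim_add_line // dim_vline v0. Qed.

Lemma card_le_sup G P k : (\dim P <= k)%N ->
  (forall B, B \in G -> (P <= B)%VS /\ \dim B = k) ->
  #|G|%:R <= gb (n - \dim P) (k - \dim P).
Proof.
move=> Pk GP; rewrite -card_sup // ler_nat subset_leq_card //.
by apply/subsetP => B /GP[PB dB]; rewrite inE PB dB /=.
Qed.

Lemma card_setU_disjoint (T : finType) (A B C : {set T}) :
  C = A :|: B -> (forall x, x \in A -> x \notin B) ->
  #|C|%:R = #|A|%:R + #|B|%:R :> rat.
Proof.
move=> -> AB; rewrite cardsU disjoint_setI0 ?cards0 ?subn0 ?natrD //.
by rewrite disjoints_subset; apply/subsetP => x /AB; rewrite inE.
Qed.

Section HM.
Variables (t : nat) (e : V) (Y : {vspace V}).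
Hypotheses (t_gt0 : (0 < t)%N) (dY : \dim Y = (t + 1)%N) (eY : e \notin Y).
Local Notation X := <[e]>%VS.

Let e0 : e != 0. Proof. by apply: contraNneq eY => ->; exact: mem0v. Qed.
Let dX : \dim X = 1%N. Proof. by rewrite dim_vline e0. Qed.
Let dXY : \dim (X + Y) = (t + 2)%N.
Proof. by rewrite addvC dim_add_line // dY addn1 addn2. Qed.

Definition HM_star : {set {vspace V}} :=
  [set A in grassmannian F n (t + 1) | (X <= A)%VS & (1 <= \dim (A :&: Y))%N].

Lemma HM_star_subset : HM_star \subset HM_family (t + 1) X Y.
Proof. by rewrite subsetUl. Qed.

(** All spaces through X, minus those missing Y. By the modular law A :&: (X + Y) = X + (A :&: Y)
    for A through X, so the latter are the spaces meeting X + Y exactly in X. *)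
Lemma card_HM_star :
  #|HM_star|%:R = gb (n - 1) t - Q ^+ (t * (t + 1)) * gb (n - t - 2) t.
Proof.
have XY : (X <= X + Y)%VS by rewrite addvSl.
have capE A : (X <= A)%VS -> (A :&: (X + Y) <= X)%VS = ((A :&: Y)%VS == 0%VS).
  move=> XA; apply/idP/idP => [sub|/eqP AY0].
    rewrite -subv0 -(cap_line eY) subv_cap capvSr; apply: subv_trans sub.
    by rewrite capvS // addvSr.
  by rewrite capvC -vspace_modl // subv_add subvv capvC AY0 sub0v.
have := card_ext_set t XY (subvf _).
rewrite dXY dX dim_full subnDA.
have -> : (t + 2 - 1 = t + 1)%N by nat_lia.
move=> <-.
have := @card_sup F n X (t + 1); rewrite dX addnK => <-; last by nat_lia.
apply/eqP; rewrite eq_sym subr_eq; apply/eqP; apply: card_setU_disjoint.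
  apply/setP => A; rewrite !inE dX [(1 + t)%N]addnC subvf /= lt0n dimv_eq0.
  case XA: (X <= A)%VS; last by rewrite !andbF.
  rewrite capE //; case: (\dim A == _); last by rewrite !andbF.
  by case: eqP.
move=> A; rewrite !inE lt0n dimv_eq0 => /andP[_ /andP[XA nz]].
by rewrite capE // (negPf nz) !andbF.
Qed.

(** A hyperplane of X + Y meets Y since t > 0, so those through X are already in [HM_star]; the
    remaining ones avoid X and number q^(t+1). *)
Lemma card_HM_family : #|HM_family (t + 1) X Y|%:R = hm_bound #|F| n t.
Proof.
have -> : #|HM_family (t + 1) X Y|%:R
    = #|HM_star|%:R + #|ext_set 0 X (X + Y) (t + 1)|%:R :> rat.
  apply: card_setU_disjoint => [|A].
    apply/setP => A; rewrite !inE sub0v dimv0 add0n.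
    case dA: (\dim A == _); rewrite ?andbF //=; move/eqP: dA => dA.
    rewrite -memvE; case eA: (e \in A) => /=; last first.
      by rewrite cap_line ?eA // sub0v !andbT.
    case AXY: (A <= _)%VS; rewrite ?orbT ?orbF ?andbF //=.
    have := dimv_sum_cap A Y.
    have : (A + Y <= X + Y)%VS by rewrite subv_add AXY addvSr.
    move=> /dimvS; rewrite dA dY dXY; set a := \dim (A + Y); set b := \dim _.
    by move=> h1 h2; rewrite (_ : (0 < b)%N) //; nat_lia.
  rewrite !inE dimv0 => /andP[_ /andP[XA _]]; apply/negP => /and4P[_ _ sub _].
  by move: sub; rewrite (capv_idPr XA) subv0 -dimv_eq0 dX.
rewrite card_HM_star card_ext_set ?sub0v ?addvSl // dXY dX dimv0 subn0 muln1.
have -> : (t + 2 - 1 = t + 1)%N by nat_lia.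
by rewrite gbnn // mulr1.
Qed.

(** Counts only the members of [HM_star] meeting Y in a single point <v>: the spaces through X +
    <v>, minus those meeting Y in more. The result is expressed in the quantities that the branching
    bounds produce. *)
Lemma hm_bound_ge : (2 <= t)%N ->
  gb (t + 1) 1 * (gb (n - 2) (t - 1) - gb t 1 * gb (n - 3) (t - 2))
  <= hm_bound #|F| n t.
Proof.
move=> t2; rewrite -card_HM_family.
pose S := [set A in HM_star | \dim (A :&: Y) == 1%N].
apply: (le_trans (y := #|S|%:R)); last first.
  rewrite ler_nat subset_leq_card //; apply: subset_trans HM_star_subset.
  by apply/subsetP => A; rewrite inE => /andP[].
have hq := ge2q q1; rewrite gb1 mulrAC ler_pdivrMr; last by lra.
have := double_count S [set v | (v \in Y) && (v != 0)].
move/(congr1 (fun m : nat => m%:R : rat)); rewrite !natr_sum => H.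
have <- : \sum_(B in S) #|[set v in [set v | (v \in Y) && (v != 0)] | v \in B]|%:R
    = #|S|%:R * (Q - 1).
  rewrite mulr_natl -sumr_const; apply: eq_bigr => B; rewrite inE => /andP[_ /eqP dB].
  have := card_nonzero (B :&: Y); rewrite dB expr1 => <-.
  congr (_%:R); apply: eq_card => v.
  by rewrite !inE memv_cap andbC andbA.
rewrite {}H -dY -card_nonzero mulr_natl -sumr_const; apply: ler_sum => v.
rewrite inE => /andP[vY v0].
have vX : v \notin X.
  by apply/negP => vX; move: v0; rewrite -memv0 -(cap_line eY) memv_cap vY vX.
pose P := (X + <[v]>)%VS; have dP : \dim P = 2%N by rewrite dim_line2.
(* A complement of <v> in Y has dimension t, so every subspace of Y of dimension at least 2 meets
   it; this provides a third independent vector. *)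
pose R := (Y :\: <[v]>)%VS.
have dR : \dim R = t.
  have := dimv_cap_compl Y <[v]>; rewrite dY (capv_idPr _) -?memvE // dim_vline v0.
  by rewrite -/R; nat_lia.
pose S2 := [set A | [&& (P <= A)%VS, \dim A == (t + 1)%N & (1 < \dim (A :&: Y))%N]].
have cS2 : #|S2|%:R <= gb t 1 * gb (n - 3) (t - 2).
  rewrite -[in gb t 1]dR; apply: cover_bound_const => [A|u uR u0].
    rewrite inE => /and3P[PA /eqP dA dAY]; rewrite -dimv_eq0 -lt0n.
    have RY : (R <= Y)%VS by exact: diffvSl.
    have := dimv_sum_cap (A :&: Y) R.
    have : (A :&: Y + R <= Y)%VS by rewrite subv_add capvSr.
    move/dimvS; rewrite dY dR -capvA (capv_idPr RY).
    set a := \dim (A :&: Y) in dAY *; set b := \dim (_ + _); set c := \dim _.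
    by nat_lia.
  have uP : u \notin P.
    have uY : u \in Y by apply: (subvP (diffvSl Y <[v]>)).
    apply/negP => uP.
    have : u \in (<[v]> + X :&: Y)%VS.
      by rewrite vspace_modl -?memvE // memv_cap uY addvC uP.
    rewrite capvC cap_line // addv0 => uv.
    by move: u0; rewrite -memv0 -(capv_diff Y <[v]>) memv_cap uR uv.
  have dPu : \dim (P + <[u]>) = 3%N by rewrite dim_add_line // dP.
  have -> : (t - 2 = t + 1 - 3)%N by nat_lia.
  rewrite -dPu; apply: card_le_sup => [|A]; first by rewrite dPu; nat_lia.
  rewrite !inE => /andP[/and3P[PA /eqP dA _] uA].
  by rewrite subv_add PA -memvE uA.
have cP := @card_sup F n P (t + 1).
rewrite dP (_ : (t + 1 - 2 = t - 1)%N) in cP; last by nat_lia.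
rewrite -cP; last by nat_lia.
rewrite lerBlDr; apply: le_trans (lerD (lexx _) cS2).
rewrite -natrD ler_nat; apply: leq_trans (leq_card_setU _ _).1.
rewrite subset_leq_card //; apply/subsetP => A.
rewrite !inE => /andP[PA dA]; rewrite PA dA /=.
move: (PA); rewrite subv_add => /andP[XA]; rewrite -memvE => vA.
rewrite !memvE XA vA /= !andbT.
have : (0 < \dim (A :&: Y))%N.
  by rewrite lt0n dimv_eq0; apply/cap_neq0P; exists v; rewrite // memvE vA.
by case: (\dim (A :&: Y)) => [|[|d]].
Qed.

End HM.

Lemma card_HM_family_dim1 t X Y : (0 < t)%N -> \dim X = 1%N ->
  \dim Y = (t + 1)%N -> ~~ (X <= Y)%VS ->
  #|HM_family (t + 1) X Y|%:R = hm_bound #|F| n t.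
Proof.
move=> t0 dX dY; have [e e0 ->] := vline_of_dim1 dX; rewrite -memvE => eY.
exact: card_HM_family.
Qed.

Lemma card_HMstar_family Y : \dim Y = 3%N -> (4 <= n)%N ->
  #|HMstar_family Y|%:R = hm_bound #|F| n 2.
Proof.
move=> dY n4.
pose lines := [set L : {vspace V} | (L <= Y)%VS && (\dim L == 2%N)].
pose S := \bigcup_(L in lines) ext_set L Y fullv 1.
have HE : HMstar_family Y = Y |: S.
  apply/setP => A; rewrite !inE; apply/idP/idP.
    move=> /andP[/eqP dA d2].
    have [d3|dn3] := eqVneq (\dim (A :&: Y)) 3%N.
      apply/orP; left; apply/eqP.
      have /eqP <- : ((A :&: Y)%VS == A) by rewrite eqEdim capvSl dA d3.
      by apply/eqP; rewrite eqEdim capvSr dY d3.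
    have dAY : \dim (A :&: Y) = 2%N.
      by have := dimvS (capvSl A Y); rewrite dA; move/eqP: dn3; nat_lia.
    apply/orP; right; apply/bigcupP; exists (A :&: Y)%VS.
      by rewrite inE capvSr dAY.
    by rewrite inE capvSl subvf subvv dA dAY.
  case/orP => [/eqP->|/bigcupP[L]]; first by rewrite capvv dY.
  rewrite !inE => /andP[LY /eqP dL] /and4P[LA _ _ /eqP dA].
  rewrite dA dL /=; rewrite -dL dimvS // subv_cap LA LY //.
have YS : Y \notin S.
  apply/bigcupP => -[L]; rewrite !inE capvv => /andP[LY /eqP dL] /and4P[_ _ YL _].
  by have := dimvS YL; rewrite dL dY.
have cS : #|S|%:R = gb 3 2 * (Q * gb (n - 3) 1).
  rewrite -dY -card_subspaces -/lines.
  have cL L : L \in lines -> #|ext_set L Y fullv 1|%:R = Q * gb (n - 3) 1.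
    rewrite inE => /andP[LY /eqP dL].
    by rewrite card_ext_set ?subvf // dim_full dY dL mul1n expr1.
  rewrite -[S]cover_imset.
  (* Any A in a fibre determines L as A :&: Y. Injectivity also needs nonempty fibres, which is
     where n >= 4 enters. *)
  have inj : {in lines &, injective (fun L => ext_set L Y fullv 1)}.
    move=> L L' Ll L'l eLL.
    have : (0 < #|ext_set L Y fullv 1|%:R :> rat).
      by rewrite cL // mulr_gt0 ?q_gt0 // gb_gt0 //; nat_lia.
    rewrite ltr0n => /card_gt0P[A AL].
    have : A \in ext_set L' Y fullv 1 by rewrite -eLL.
    move: AL Ll L'l; rewrite !inE => /and4P[LA _ sA _] /andP[LY _] /andP[L'Y _].
    move=> /and4P[L'A _ sA' _].
    apply/eqP; rewrite eqEsubv (subv_trans _ sA') ?subv_cap ?LA //=.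
    by rewrite (subv_trans _ sA) // subv_cap L'A.
  have triv : trivIset [set ext_set L Y fullv 1 | L in lines].
    apply/trivIsetP => _ _ /imsetP[L Ll ->] /imsetP[L' L'l ->] neq.
    rewrite -setI_eq0; apply: contraNT neq => /set0Pn[A].
    rewrite !inE => /andP[/and4P[LA _ sA _] /and4P[L'A _ sA' _]].
    move: Ll L'l; rewrite !inE => /andP[LY _] /andP[L'Y _].
    suff -> : L = L' by [].
    apply/eqP; rewrite eqEsubv (subv_trans _ sA') ?subv_cap ?LA //=.
    by rewrite (subv_trans _ sA) // subv_cap L'A.
  rewrite -(eqnP triv) big_imset //= natr_sum.
  by rewrite (eq_bigr _ cL) sumr_const [RHS]mulr_natl dY.
rewrite HE cardsU1 YS natrD cS /hm_bound.
have [m ->] : exists m, n = (m + 4)%N by exists (n - 4)%N; nat_lia.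
have -> : (m + 4 - 3 = m.+1)%N by nat_lia.
have -> : (m + 4 - 1 = m.+3)%N by nat_lia.
have -> : (m + 4 - 2 - 2 = m)%N by nat_lia.
exact: HMstar_identity.
Qed.

End HMFamilies.

(** * The Hilton-Milner theorem *)

Lemma gbSS_ge (q m k : nat) : (1 < q)%N -> (k <= m)%N ->
  q%:R ^+ (m - k) * gauss_binom q m k <= gauss_binom q m.+1 k.+1.
Proof.
move=> q1 km; rewrite gbSS ler_wpM2r ?gb_ge0 // ler_pdivlMr ?expqB1_gt0 //.
rewrite mulrBr mulr1 -exprD.
have -> : (m - k + k.+1 = m.+1)%N by nat_lia.
by rewrite lerB // expq_ge1.
Qed.

Section HMArithmetic.
(* In the application r = q, x = q^t, a = [t,1], k = a + x = [t+1,1], and the ratio of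
   M = [n-2,t-1] to w = [n-3,t-2] is at least q^(4t+2). *)
Variables r x a M w : rat.
Hypotheses (hr : 2 <= r) (hx : r * r <= x) (ha : 0 <= a) (hax : a <= x) (hw : 0 < w).
Hypothesis hM : r ^+ 2 * x ^+ 4 * w <= M.
Hypothesis hkx : a + x <= r * x.
Local Notation k := (a + x).

Let x4 : 4 <= x.
Proof. by apply: le_trans hx; rewrite (_ : 4 = 2 * 2) // ler_pM. Qed.
Let rx0 : 0 <= r * x.
Proof. by rewrite mulr_ge0 //; [move: hr|move: x4] => *; lra. Qed.

Lemma hm_arith_none : k * (k * (k * w)) < k * (M - a * w).
Proof.
have hr' := hr; have hx' := hx; have ha' := ha; have hax' := hax; have hw' := hw.
have hkx' := hkx; have x4' := x4; have rx0' := rx0.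

rewrite ltr_pM2l; last by lra.
rewrite ltrBrDr; apply: lt_le_trans hM.
have -> : k * (k * w) + a * w = (k * k + a) * w by ring.
rewrite ltr_pM2r // (le_lt_trans (y := (r * x) * (r * x) + x)) //.
  by rewrite lerD // ler_pM //; lra.
have -> : r ^+ 2 * x ^+ 4 = (r * x) * (r * x) * (x * x) by ring.
have : 16 <= x * x by nra.
have : 8 <= r * x by nra.
move=> h1 h2; nra.
Qed.

(** What remains of [hm_arith_point] once a * M is cancelled from k * (M - a * w); [hm_arith_plane]
    follows from it too. *)
Lemma hm_arith_aux : (r + 2) * (k * k) * w + k * a * w < x * M.
Proof.
have hr' := hr; have hx' := hx; have ha' := ha; have hax' := hax; have hw' := hw.
have hkx' := hkx; have x4' := x4; have rx0' := rx0.

have x0 : 0 < x by lra.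
apply: (lt_le_trans (y := x * (r ^+ 2 * x ^+ 4 * w))); last by rewrite ler_pM2l.
have -> : (r + 2) * (k * k) * w + k * a * w = ((r + 2) * (k * k) + k * a) * w by ring.
rewrite [ltRHS]mulrA ltr_pM2r //.
have h1 : k * k <= (r * x) * (r * x) by rewrite ler_pM //; lra.
have h2 : k * a <= (r * x) * (r * x).
  by rewrite ler_pM //; [lra|nra].
apply: (le_lt_trans (y := (r + 3) * ((r * x) * (r * x)))); first by nra.
have -> : x * (r ^+ 2 * x ^+ 4) = (x * (x * x)) * ((r * x) * (r * x)) by ring.
rewrite ltr_pM2r; last by nra.
have : 16 <= x * x by nra.
by nra.
Qed.

Lemma hm_arith_point : a * M + k * (k * w) + (r + 1) * (k * (k * w)) < k * (M - a * w).
Proof.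
have hr' := hr; have hx' := hx; have ha' := ha; have hax' := hax; have hw' := hw.
have hkx' := hkx; have x4' := x4; have rx0' := rx0.
by have := hm_arith_aux; lra. Qed.

Lemma hm_arith_plane c : c <= a -> c * M < k * (M - a * w).
Proof.
have hr' := hr; have hx' := hx; have ha' := ha; have hax' := hax; have hw' := hw.
have hkx' := hkx; have x4' := x4; have rx0' := rx0.

move=> ca; have M0 : 0 <= M by apply: le_trans hM; rewrite !mulr_ge0 ?exprn_ge0 //; lra.
have h : c * M <= a * M by rewrite ler_wpM2r.
have h0 : 0 <= (r + 2) * (k * k) * w by rewrite !mulr_ge0 //; lra.
by have := hm_arith_aux; lra.
Qed.

End HMArithmetic.

Section HiltonMilner.
Variables (F : finFieldType) (n t : nat).
Local Notation V := 'rV[F]_n.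
Implicit Types (A B P U W X Y L T : {vspace V}) (e u v : V).
Local Notation Q := (#|F|%:R : rat).
Local Notation gb := (gauss_binom #|F|).
Hypotheses (t_ge2 : (2 <= t)%N) (n_ge : (5 * t + 3 <= n)%N).
Let q1 : (1 < #|F|)%N := finNzRing_gt1 F.
Local Notation M := (gb (n - 2) (t - 1)).
Local Notation w := (gb (n - 3) (t - 2)).
Local Notation k1 := (gb (t + 1) 1).

Let qB1_gt0 : 0 < Q - 1.
Proof. by have := expqB1_gt0 q1 0; rewrite expr1. Qed.
Let w_gt0 : 0 < w. Proof. by rewrite gb_gt0 //; nat_lia. Qed.
Let k1E : k1 = gb t 1 + Q ^+ t. Proof. by rewrite addn1 gb1S. Qed.

Let hm_side : [/\ 2 <= Q, Q * Q <= Q ^+ t, 0 <= gb t 1, gb t 1 <= Q ^+ t & 0 < w].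
Proof.
split; rewrite ?ge2q ?gb_ge0 ?gb1_le ?w_gt0 //.
by rewrite -expr2 leq_expq.
Qed.

(** One application of [gbSS_ge] gives the ratio q^(n-t-1), and n - t - 1 >= 4t + 2 is the
    hypothesis on n. *)
Let hm_M : Q ^+ 2 * (Q ^+ t) ^+ 4 * w <= M.
Proof.
have -> : (n - 2 = (n - 3).+1)%N by nat_lia.
have -> : (t - 1 = (t - 2).+1)%N by nat_lia.
apply: le_trans (gbSS_ge q1 _); last by nat_lia.
rewrite ler_wpM2r ?gb_ge0 // -exprM -exprD leq_expq //; nat_lia.
Qed.

Let hm_k : gb t 1 + Q ^+ t <= Q * Q ^+ t.
Proof. by rewrite -k1E addn1 -exprS gb1_le. Qed.

Section Family.
Variable G : {set {vspace V}}.
Hypothesis Gdim : forall B, B \in G -> \dim B = (t + 1)%N.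
Hypothesis Gint : forall A B, A \in G -> B \in G -> (A :&: B)%VS != 0%VS.
Hypothesis Gtau : forall e, e != 0 -> exists2 A, A \in G & e \notin A.

Definition transversal_of T := [forall A in G, (A :&: T)%VS != 0%VS].

Lemma transversal_ofPn T : ~~ transversal_of T ->
  exists2 A, A \in G & (A :&: T = 0)%VS.
Proof.
rewrite negb_forall => /existsP[A]; rewrite negb_imply negbK => /andP[AG /eqP AT].
by exists A.
Qed.

Local Notation star := (star_at G).

Lemma star2_le u v : v != 0 -> u \notin <[v]>%VS -> #|star_at (star v) u|%:R <= M.
Proof.
move=> v0 uv; have dL := dim_line2 v0 uv.
have -> : (t - 1 = t + 1 - 2)%N by nat_lia.
rewrite -dL; apply: card_le_sup => [|B]; first by rewrite dL; nat_lia.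
rewrite !inE => /andP[/andP[BG vB] uB].
by rewrite subv_add -!memvE vB uB Gdim.
Qed.

(** Some member A misses the 2-space <v,u>, while every member through <v,u> meets A; branching over
    A fixes a third independent point and replaces M by the much smaller k1 * w. *)
Lemma star2_nontransversal_le u v : v != 0 -> u \notin <[v]>%VS ->
  ~~ transversal_of (<[v]> + <[u]>)%VS -> #|star_at (star v) u|%:R <= k1 * w.
Proof.
move=> v0 uv /transversal_ofPn[A AG AL]; rewrite -(Gdim AG).
have dL := dim_line2 v0 uv.
apply: cover_bound_const => [B|z zA z0].
  by rewrite !inE => /andP[/andP[BG _] _]; apply: Gint.
have zL : z \notin (<[v]> + <[u]>)%VS.
  by apply: contraNN z0 => zL; rewrite -memv0 -AL memv_cap zA.
have dz : \dim (<[v]> + <[u]> + <[z]>) = 3%N by rewrite dim_add_line // dL.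
have -> : (t - 2 = t + 1 - 3)%N by nat_lia.
rewrite -dz; apply: card_le_sup => [|B]; first by rewrite dz; nat_lia.
rewrite !inE => /andP[/andP[/andP[BG vB] uB] zB].
by rewrite !subv_add -!memvE vB uB zB Gdim.
Qed.

Let exists_vec : exists e : V, e != 0.
Proof.
have [|X _ dX] := @exists_dim F n fullv 1; first by rewrite dim_full; nat_lia.
by have [e e0 _] := vline_of_dim1 dX; exists e.
Qed.

Let hm_ge : k1 * (M - gb t 1 * w) <= hm_bound #|F| n t.
Proof.
have [e e0] := exists_vec; have [A AG eA] := Gtau e0.
by apply: hm_bound_ge eA _; rewrite ?Gdim //; nat_lia.
Qed.

Lemma notin_line A e u : e \notin A -> u \in A -> u != 0 -> u \notin <[e]>%VS.
Proof.
move=> eA uA u0; apply: contraNN u0 => uX.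
by rewrite -memv0 -(cap_line eA) memv_cap uA uX.
Qed.

(** Branch over a member, then over a member missing the chosen point, then over one missing the
    resulting 2-space: three factors k1. *)
Lemma HM_no_transversal :
  (forall T, \dim T = 2%N -> ~~ transversal_of T) -> #|G|%:R < hm_bound #|F| n t.
Proof.
move=> noT; apply: lt_le_trans hm_ge.
have [e e0] := exists_vec; have [A AG _] := Gtau e0.
have [h1 h2 h3 h4 h5] := hm_side.
apply: le_lt_trans (_ : k1 * (k1 * (k1 * w)) < _); last first.
  by rewrite k1E; apply: hm_arith_none h1 h2 h3 h4 h5 hm_M hm_k.
rewrite -{1}(Gdim AG); apply: cover_bound_const => [B BG|v vA v0]; first exact: Gint.
have [B BG vB] := Gtau v0; rewrite -{1}(Gdim BG).
apply: cover_bound_const => [C|u uB u0].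
  by rewrite inE => /andP[CG _]; apply: Gint.
have uv := notin_line vB uB u0.
by apply: star2_nontransversal_le => //; apply: noT; exact: dim_line2.
Qed.

(* The points p of A for which <e, p> is transversal form the subspace S. *)
Lemma HM_transversals_through_point e T0 :
  e != 0 -> \dim T0 = 2%N -> transversal_of T0 ->
  (forall T, \dim T = 2%N -> transversal_of T -> e \in T) ->
  #|G|%:R < hm_bound #|F| n t \/
  exists Y, [/\ \dim Y = (t + 1)%N, e \notin Y & G \subset HM_family (t + 1) <[e]> Y].
Proof.
move=> e0 dT0 trT0 allT; have [A AG eA] := Gtau e0.
pose S := (A :&: \bigcap_(B in [set B in G | e \notin B]) (B + <[e]>))%VS.
have SP p : p \in S -> forall B, B \in G -> e \notin B -> p \in (B + <[e]>)%VS.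
  rewrite memv_cap => /andP[_ pS] B BG eB.
  by apply: (subvP _ _ pS); apply: (@bigcapv_inf _ _ _ B); rewrite ?inE ?BG.
have trS p : p \in A -> p != 0 -> p \notin S ->
    ~~ transversal_of (<[e]> + <[p]>)%VS.
  move=> pA p0; apply: contraNN => /forallP tr; rewrite memv_cap pA memvE.
  apply/subv_bigcapP => B; rewrite inE => /andP[BG eB]; rewrite -memvE.
  have /cap_neq0P[z z0 /andP[zB]] := implyP (tr B) BG.
  case/memv_addP => _ /vlineP[a ->] [_ /vlineP[b ->] zE].
  have b0 : b != 0.
    apply: contraNneq z0 => b0; move: zB; rewrite zE b0 scale0r addr0 => aeB.
    have [->|a0] := eqVneq a 0; first by rewrite scale0r.
    by case/negP: eB; rewrite -[e](scalerK a0) memvZ.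
  have -> : p = b^-1 *: z + - (b^-1 * a) *: e.
    by rewrite zE scalerDr !scalerA mulVf // scale1r addrAC scaleNr subrr add0r.
  by rewrite memv_add ?memvZ ?memv_line.
(* If S = A, each member B missing e satisfies A + <e> = B + <e>, hence lies in <e> + A, and members
   through e meet A: the witness is Y = A. *)
have [SA|nSA] := boolP (A <= S)%VS.
  right; exists A; split=> //; first exact: Gdim.
  apply/subsetP => B BG; rewrite !inE -memvE (Gdim BG) eqxx /= lt0n dimv_eq0.
  rewrite Gint //= andbT; case eB: (e \in B) => //=.
  have sAB : (A + <[e]> <= B + <[e]>)%VS.
    rewrite subv_add addvSr andbT; apply/subvP => p /(subvP SA) pS.
    by apply: (SP p pS B BG); rewrite eB.
  have /eqP E : (A + <[e]>)%VS == (B + <[e]>)%VS.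
    by rewrite eqEdim sAB !dim_add_line ?eB // !Gdim //=.
  by rewrite addvC E addvSl.
(* Now S has dimension at most t. Members through e are counted over the points of A: at most [t,1]
   points, those of S, cost M, the others only k1 * w. *)
left; apply: lt_le_trans hm_ge.
have [h1 h2 h3 h4 h5] := hm_side.
apply: le_lt_trans (_ : gb t 1 * M + k1 * (k1 * w) + (Q + 1) * (k1 * (k1 * w)) < _);
  last first.
  by rewrite k1E; apply: hm_arith_point h1 h2 h3 h4 h5 hm_M hm_k.
have dS : (\dim S <= t)%N.
  have SleA : (S <= A)%VS by exact: capvSl.
  have := dimv_leqif_sup SleA; rewrite (Gdim AG) => -[].
  by rewrite (negPf nSA) => le /eqP; nat_lia.
have kw0 : 0 <= k1 * w by rewrite mulr_ge0 ?gb_ge0.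
have cG : #|G|%:R = #|star e|%:R + #|G :\: star e|%:R :> rat.
  apply: card_setU_disjoint => [|B]; last by rewrite !inE => ->.
  by apply/setP => B; rewrite !inE; case: (B \in G); case: (e \in B).
rewrite {}cG lerD //.
  have : #|star e|%:R * (Q - 1) <= (Q ^+ t - 1) * M + (Q ^+ (t + 1) - 1) * (k1 * w).
    apply: (le_trans (cover_bound (A := A) _)) => [B|].
      by rewrite inE => /andP[BG _]; apply: Gint.
    rewrite (bigID (mem S)) /=; apply: lerD.
      apply: (le_trans (y := \sum_(v in [set v | (v \in S) && (v != 0)]) M)).
        have SleA : (S <= A)%VS by exact: capvSl.
        rewrite (eq_bigl (fun v => v \in [set v | (v \in S) && (v != 0)])) => [|v]; last first.
          rewrite !inE; case vS: (v \in S); rewrite ?andbF ?andbT //=.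
          by rewrite (subvP SleA).
        apply: ler_sum => v; rewrite inE => /andP[vS v0].
        by apply: star2_le => //; apply: notin_line eA _ _; rewrite ?(subvP SleA).
      rewrite sumr_const -[M *+ _]mulr_natl ler_wpM2r ?gb_ge0 // card_nonzero lerB //.
      exact: leq_expq.
    have := card_nonzero A; rewrite (Gdim AG) => <-; rewrite mulr_natl -sumr_const.
    rewrite [leRHS](bigID (mem S)) /=; apply: ler_wpDl; first by apply: sumr_ge0 => v _.
    apply: ler_sum => v; rewrite inE => /andP[/andP[vA v0] vS].
    by apply: star2_nontransversal_le; rewrite ?trS //; apply: notin_line eA _ _.
  move=> H; rewrite !gb1.
  have -> : (Q ^+ t - 1) / (Q - 1) * M + (Q ^+ (t + 1) - 1) / (Q - 1) *
      ((Q ^+ (t + 1) - 1) / (Q - 1) * w)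
    = ((Q ^+ t - 1) * M + (Q ^+ (t + 1) - 1) * (k1 * w)) / (Q - 1).
    by rewrite gb1; field; rewrite gt_eqF.
  by rewrite ler_pdivlMr.
(* Members missing e are counted over the q + 1 points of [T0], and then over a member avoiding the
   chosen point. *)
have -> : Q + 1 = gb (\dim T0) 1.
  by rewrite dT0 gb1; field; rewrite gt_eqF.
apply: cover_bound_const => [B|v vT v0].
  by rewrite inE => /andP[_ BG]; move/forallP/(_ B)/implyP: trT0; apply.
have [B BG vB] := Gtau v0; rewrite -{1}(Gdim BG).
apply: cover_bound_const => [C|u uB u0].
  by rewrite !inE => /andP[/andP[_ CG] _]; apply: Gint.
have uv := notin_line vB uB u0.
(* A transversal <v,u> would contain e, so no member missing e passes through it. *)
have [tr|ntr] := boolP (transversal_of (<[v]> + <[u]>)%VS).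
  rewrite (_ : star_at _ _ = set0) ?cards0 //.
  apply/setP => C; rewrite !inE; apply/negP.
  move=> /andP[/andP[/andP[eC CG] vC] uC]; move: eC; rewrite CG /=.
  have := allT _ (dim_line2 v0 uv) tr.
  suff /subvP sC : (<[v]> + <[u]> <= C)%VS by move/sC => ->.
  by rewrite subv_add -!memvE vC uC.
apply: le_trans (star2_nontransversal_le v0 uv ntr).
rewrite ler_nat subset_leq_card //; apply/subsetP => C.
by rewrite !inE => /andP[/andP[/andP[_ ->] ->] ->].
Qed.

(** Take transversals [T0] and [T1] meeting in <f>, and [T2] missing f. As [T2] meets both, it lies
    in Y = [T0 + T1]. A member meeting Y in one point <x> only would have x in all three, forcing
    <x> = <f>. *)
Lemma HM_transversals_in_plane :
  (forall T T', \dim T = 2%N -> \dim T' = 2%N -> transversal_of T ->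
     transversal_of T' -> (T :&: T')%VS != 0%VS) ->
  (exists2 T, \dim T = 2%N & transversal_of T) ->
  (forall e, e != 0 ->
     exists T, [/\ \dim T = 2%N, transversal_of T & e \notin T]) ->
  exists2 Y, \dim Y = 3%N & forall B, B \in G -> (2 <= \dim (B :&: Y))%N.
Proof.
move=> trI [T0 d0 tr0] noE.
have [T1 [d1 tr1 v1]] : exists T, [/\ \dim T = 2%N, transversal_of T & vpick T0 \notin T].
  by apply: noE; rewrite vpick0 -dimv_eq0 d0.
have d01 : \dim (T0 :&: T1) = 1%N.
  have := trI _ _ d0 d1 tr0 tr1; rewrite -dimv_eq0.
  have : (\dim (T0 :&: T1) < 2)%N.
    rewrite ltn_neqAle -{2}d0 dimvS ?capvSl // andbT; apply: contraNN v1 => /eqP d.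
    have /eqP E : (T0 :&: T1)%VS == T0 by rewrite eqEdim capvSl d d0.
    by have := memv_pick T0; rewrite -{2}E memv_cap => /andP[].
  by case: (\dim (T0 :&: T1)) => [|[|d]].
have [f f0 fE] := vline_of_dim1 d01.
have [T2 [d2 tr2 f2]] := noE f f0.
exists (T0 + T1)%VS.
  by have := dimv_sum_cap T0 T1; rewrite d01 d0 d1; nat_lia.
move=> B BG.
rewrite leqNgt; apply/negP => dB.
have trB T : transversal_of T -> (B :&: T)%VS != 0%VS.
  by move/forallP/(_ B)/implyP; apply.
have /cap_neq0P[x x0 /andP[xB xT0]] := trB _ tr0.
have xE y : y != 0 -> y \in B -> y \in (T0 + T1)%VS -> y \in <[x]>%VS.
  move=> y0 yB yT; apply: contraTT dB => yx; rewrite -leqNgt -(dim_line2 x0 yx).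
  rewrite dimvS // subv_cap !subv_add -!memvE xB yB yT andbT /=.
  by rewrite (subvP (addvSl T0 T1)).
have xline T z : z != 0 -> z \in T -> z \in <[x]>%VS -> x \in T.
  move=> z0 zT /vlineP[c zE]; have c0 : c != 0.
    by apply: contraNneq z0 => c0; rewrite zE c0 scale0r.
  by rewrite -[x](scalerK c0) -zE memvZ.
have xT1 : x \in T1.
  have /cap_neq0P[z z0 /andP[zB zT]] := trB _ tr1.
  by apply: (xline _ z) => //; apply: xE => //; apply: (subvP (addvSr T0 T1)).
have sT2 : (T2 <= T0 + T1)%VS.
  have /cap_neq0P[a a0 /andP[aT0 aT2]] := trI _ _ d0 d2 tr0 tr2.
  have /cap_neq0P[b b0 /andP[bT1 bT2]] := trI _ _ d1 d2 tr1 tr2.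
  have ba : b \notin <[a]>%VS.
    apply: contraNN f2 => /vlineP[c bE].
    have bT0 : b \in T0 by rewrite bE memvZ.
    have : b \in <[f]>%VS by rewrite -fE memv_cap bT0.
    case/vlineP => c' bE'; have c0 : c' != 0.
      by apply: contraNneq b0 => c0; rewrite bE' c0 scale0r.
    by rewrite -[f](scalerK c0) -bE' memvZ.
  have /eqP <- : (<[a]> + <[b]>)%VS == T2.
    by rewrite eqEdim subv_add -!memvE aT2 bT2 d2 dim_line2.
  by rewrite subv_add -!memvE (subvP (addvSl T0 T1)) // (subvP (addvSr T0 T1)).
have xT2 : x \in T2.
  have /cap_neq0P[z z0 /andP[zB zT]] := trB _ tr2.
  by apply: (xline _ z) => //; apply: xE => //; apply: (subvP sT2).
have : x \in <[f]>%VS by rewrite -fE memv_cap xT0.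
case/vlineP => c xE'; have c0 : c != 0.
  by apply: contraNneq x0 => c0; rewrite xE' c0 scale0r.
by case/negP: f2; rewrite -[f](scalerK c0) -xE' memvZ.
Qed.

(** Each member contains one of the [3,2] subspaces of dimension 2 of Y. Since [3,2] = [3,1] <=
    [t,1] for t >= 3, the main term loses at least q^t * M against [t+1,1] * M. *)
Lemma HM_plane_le Y : (3 <= t)%N -> \dim Y = 3%N ->
  (forall B, B \in G -> (2 <= \dim (B :&: Y))%N) -> #|G|%:R < hm_bound #|F| n t.
Proof.
move=> t3 dY GY; apply: lt_le_trans hm_ge.
have [h1 h2 h3 h4 h5] := hm_side.
apply: le_lt_trans (_ : gb 3 2 * M < _); last first.
  rewrite k1E; apply: hm_arith_plane h1 h2 h3 h4 h5 hm_M hm_k _ _.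
  by rewrite (gb_pred q1 2) !gb1 ler_pM2r ?invr_gt0 ?lerB ?leq_expq.
pose lines := [set L : {vspace V} | (L <= Y)%VS && (\dim L == 2%N)].
pose cov := \bigcup_(L in lines) [set B : {vspace V} | (L <= B)%VS && (\dim B == t + 1)%N].
have sG : G \subset cov.
  apply/subsetP => B BG; have [L sL dL] := exists_dim (GY _ BG).
  move: sL; rewrite subv_cap => /andP[LB LY].
  by apply/bigcupP; exists L; rewrite !inE ?LY ?dL // LB Gdim /=.
apply: (le_trans (y := #|cov|%:R)); first by rewrite ler_nat subset_leq_card.
have := card_subspaces Y 2; rewrite dY => <-.
apply: card_bigcup_le => L; rewrite inE => /andP[_ /eqP dL].
rewrite card_sup dL; last by nat_lia.
by have -> : (t + 1 - 2 = t - 1)%N by nat_lia.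
Qed.

Lemma HM_core :
  (forall T T', \dim T = 2%N -> \dim T' = 2%N -> transversal_of T ->
     transversal_of T' -> (T :&: T')%VS != 0%VS) ->
  [\/ #|G|%:R < hm_bound #|F| n t,
      exists X Y, [/\ \dim X = 1%N, \dim Y = (t + 1)%N, ~~ (X <= Y)%VS &
                      G \subset HM_family (t + 1) X Y] |
      t = 2%N /\ exists2 Y, \dim Y = 3%N & G \subset HMstar_family Y].
Proof.
move=> trI.
pose tr2 := [set T : {vspace V} | (\dim T == 2%N) && transversal_of T].
have [E|[T0]] := set_0Vmem tr2.
  apply: Or31; apply: HM_no_transversal => T dT; apply/negP => trT.
  by have := in_set0 T; rewrite -E inE dT trT.
rewrite inE => /andP[/eqP dT0 trT0].
have [/existsP[e /andP[e0 /forallP allT]]|] :=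
  boolP [exists e : V, (e != 0) && [forall T in tr2, e \in T]].
  have allT' T : \dim T = 2%N -> transversal_of T -> e \in T.
    by move=> dT trT; apply: (implyP (allT T)); rewrite inE dT trT.
  have [|[Y [dY eY GY]]] := HM_transversals_through_point e0 dT0 trT0 allT'.
    by move=> ?; apply: Or31.
  by apply: Or32; exists <[e]>%VS, Y; rewrite dim_vline e0 -memvE.
rewrite negb_exists => /forallP noE.
have [||Y dY GY] := HM_transversals_in_plane trI; first by exists T0.
  move=> e e0; have := noE e; rewrite e0 /= negb_forall => /existsP[T].
  by rewrite negb_imply inE => /andP[/andP[/eqP dT trT] eT]; exists T.
have [t3|t3] := leqP 3 t; first by apply: Or31; apply: HM_plane_le dY GY.
have t2 : t = 2%N by nat_lia.
apply: Or33; split=> //; exists Y => //; apply/subsetP => B BG.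
by rewrite !inE (Gdim BG) t2 GY.
Qed.

End Family.

(** * Passing to maximal intersecting families *)

Definition intersecting (G : {set {vspace V}}) :=
  [forall A in G, (\dim A == (t + 1)%N) &&
     [forall B in G, (A :&: B)%VS != 0%VS]].

Lemma intersectingP (G : {set {vspace V}}) :
  reflect ((forall A, A \in G -> \dim A = (t + 1)%N) /\
           (forall A B, A \in G -> B \in G -> (A :&: B)%VS != 0%VS))
          (intersecting G).
Proof.
apply: (iffP idP) => [/forallP H|[H1 H2]].
  split=> [A|A B] AG; have /implyP/(_ AG)/andP[/eqP dA /forallP HA] := H A => //.
  exact: implyP (HA B).
apply/forallP => A; apply/implyP => AG; rewrite H1 // eqxx /=.
by apply/forallP => B; apply/implyP => BG; apply: H2.
Qed.

(* In a maximal intersecting family every (t+1)-space through a transversal is a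
   member, so two transversals cannot be disjoint. *)
Lemma maximal_transversals_meet (G : {set {vspace V}}) : maxset intersecting G ->
  forall T T', \dim T = 2%N -> \dim T' = 2%N -> transversal_of G T ->
    transversal_of G T' -> (T :&: T')%VS != 0%VS.
Proof.
move=> maxG T T' dT dT' /forallP trT /forallP trT'; apply/negP => /eqP TT'.
have /intersectingP[Gd Gi] := maxsetp maxG.
(* Provides a (t+1)-space B with B :&: (T + T') = T. It meets every member through T, hence is a
   member by maximality, yet it misses T'. *)
have := card_ext_set (t - 1) (addvSl T T') (subvf _).
rewrite (dimv_disjoint_sum TT') dT dT' dim_full => cE.
have : 0 < #|ext_set T (T + T') fullv (t - 1)|%:R :> rat.
  by rewrite cE mulr_gt0 ?expq_gt0 // gb_gt0 //; nat_lia.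
rewrite ltr0n => /card_gt0P[B]; rewrite inE dT => /and4P[TB _ sB /eqP dB].
have BT' : (B :&: T' = 0)%VS.
  apply/eqP; rewrite -subv0 -TT' subv_cap capvSr andbT; apply: subv_trans sB.
  by rewrite capvS // addvSr.
have BG : B \in G.
  have <- : B |: G = G.
    apply: maxsetsup maxG _ (subsetUr _ _); apply/intersectingP.
    have BA A : A \in G -> (A :&: B)%VS != 0%VS.
      move=> AG; have := implyP (trT A) AG; rewrite -!subv0.
      by apply: contraNN; apply: subv_trans; rewrite capvS.
    split=> [A|A C]; rewrite !in_setU1.
      by case/predU1P => [->|/Gd //]; rewrite dB; nat_lia.
    case/predU1P => [->|AG] /predU1P[->|CG]; last exact: Gi.
    - by rewrite capvv -dimv_eq0 dB; nat_lia.
    - by rewrite capvC BA.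
    - exact: BA.
  by rewrite setU11.
by have := implyP (trT' B) BG; rewrite BT' eqxx.
Qed.

(** A maximal intersecting family containing G still has no common point, and its transversals
    pairwise meet. When it lies in a family H of size [hm_bound], so does G, and equality of sizes
    forces G = H. *)
Theorem hilton_milner (G : {set {vspace V}}) :
  (forall B, B \in G -> \dim B = (t + 1)%N) ->
  (forall A B, A \in G -> B \in G -> (A :&: B)%VS != 0%VS) ->
  (forall X, \dim X = 1%N -> exists2 A, A \in G & ~~ (X <= A)%VS) ->
  #|G|%:R <= hm_bound #|F| n t /\
  (#|G|%:R = hm_bound #|F| n t ->
     (exists X Y, [/\ \dim X = 1%N, \dim Y = (t + 1)%N, ~~ (X <= Y)%VS &
                      G = HM_family (t + 1) X Y]) \/
     (t = 2%N /\ exists2 Y, \dim Y = 3%N & G = HMstar_family Y)).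
Proof.
move=> Gd Gi Gt.
have [|G' maxG GG'] := @maxset_exists _ intersecting G; first exact/intersectingP.
have /intersectingP[Gd' Gi'] := maxsetp maxG.
have Gt' e : e != 0 -> exists2 A, A \in G' & e \notin A.
  move=> e0; have [|A AG eA] := Gt <[e]>%VS; first by rewrite dim_vline e0.
  by exists A; rewrite ?(subsetP GG') // memvE.
have eqG (H : {set {vspace V}}) : G' \subset H -> #|H|%:R = hm_bound #|F| n t ->
    #|G|%:R <= hm_bound #|F| n t /\ (#|G|%:R = hm_bound #|F| n t -> G = H).
  move=> G'H <-; have GH := subset_trans GG' G'H.
  rewrite ler_nat subset_leq_card //; split=> // /eqP; rewrite eqr_nat => /eqP e.
  by apply/eqP; rewrite eqEcard GH e /=.
case: (HM_core Gd' Gi' Gt' (maximal_transversals_meet maxG)).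
- move=> lt; have : #|G|%:R < hm_bound #|F| n t.
    by apply: le_lt_trans lt; rewrite ler_nat subset_leq_card.
  by move=> {}lt; split; [exact: ltW|move=> e; rewrite e ltxx in lt].
- move=> [X [Y [dX dY XY sG]]].
  have [le eq] := eqG _ sG (card_HM_family_dim1 (ltnW t_ge2) dX dY XY).
  by split=> // /eq ->; left; exists X, Y.
move=> [t2 [Y dY sG]].
have [|le eq] := eqG _ sG; first by rewrite t2 card_HMstar_family //; nat_lia.
by split=> // /eq ->; right; split=> //; exists Y.
Qed.

End HiltonMilner.

(** * Families of i-spaces meeting pairwise in dimension i - t *)

(** After cancellation this is 5t <= n; the leading 1 leaves a factor 2 to spare. *)
Lemma exponent_near t i n : (2 <= t -> t + 1 <= i -> 2 * i <= n -> 5 * t + 3 <= n ->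
  1 + ((i - t + 1) * (t - 1) + 3 * t) <= 1 * (n - i) + t * (i - t))%N.
Proof.
move=> t2 ti i2 n5.
have [x ex] : exists x, i = (t + x)%N by exists (i - t)%N; lia.
have [s es] : exists s, t = s.+1 by exists (t - 1)%N; lia.
have -> : (i - t = x)%N by lia.
have -> : (t - 1 = s)%N by lia.
by subst t i; nia.
Qed.

(** The summand 2 pays for the constant 2 * (2 * 2) * 2 = 4 * 2^2. At i = t + 1 the inequality is
    exactly n >= 5t + 3. *)
Lemma exponent_j1 t i n : (2 <= t -> t + 1 <= i -> 2 * i <= n -> 5 * t + 3 <= n ->
  2 + (1 * (i + t - 1) + 3 * t) <= 1 * (n - i) + t * (i - t))%N.
Proof.
move=> t2 ti i2 n5.
have [x ex] : exists x, i = (t + 1 + x)%N by exists (i - t - 1)%N; nat_lia.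
have [y ey] : exists y, n = (2 * i + y)%N by exists (n - 2 * i)%N; nat_lia.
have -> : (n - i = i + y)%N by nat_lia.
have -> : (i - t = x + 1)%N by nat_lia.
have : (2 * x <= t * x)%N by rewrite leq_mul2r t2 orbT.
by subst n i; nia.
Qed.

(* With x = i-t-1 and y = n-2i one has y >= 0 and 2x + y >= 3t+1; the larger of
   j and t/2 decides which of the two bounds on y is used. *)
Lemma exponent_j t i n j : (3 <= t -> 2 <= j <= t -> t + 1 <= i -> 2 * i <= n ->
  5 * t + 3 <= n ->
  j + 4 + (j * (i + t - j) + 3 * t) <= j * (n - i) + t * (i - t))%N.
Proof.
move=> t3 /andP[j2 jt] ti i2 n5.
have [x ex] : exists x, i = (t + 1 + x)%N by exists (i - t - 1)%N; nat_lia.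
have [y ey] : exists y, n = (2 * i + y)%N by exists (n - 2 * i)%N; nat_lia.
have -> : (n - i = i + y)%N by nat_lia.
have -> : (i - t = x + 1)%N by nat_lia.
have hxy : (3 * t + 1 <= 2 * x + y)%N by nat_lia.
have [z ez] : exists z, (i + t = j + z)%N by exists (i + t - j)%N; nat_lia.
have -> : (i + t - j = z)%N by nat_lia.
suff : (j + 4 + j * t + 3 * t <= j * y + t + t * x + j * j)%N by nia.
clear ez ex ey ti i2 n5 n i z.
have [tj|tj] := leqP t (2 * j).
  have h1 : (t * (3 * t + 1) <= 2 * (t * x) + 2 * j * y)%N.
    have : (t * (3 * t + 1) <= t * (2 * x + y))%N by rewrite leq_mul2l hxy orbT.
    by nia.
  by nia.
have h1 : (j * (3 * t + 1) <= t * x + j * y)%N.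
  have : (j * (3 * t + 1) <= j * (2 * x + y))%N by rewrite leq_mul2l hxy orbT.
  by nia.
by nia.
Qed.

(** * Growth of Gaussian binomials under index shifts *)

Section GaussShift.
Variable q : nat.
Hypothesis q1 : (1 < q)%N.
Local Notation Q := (q%:R : rat).
Local Notation gb := (gauss_binom q).

Lemma gb_shift1 m k : Q ^+ k * gb m k <= gb m.+1 k.
Proof.
elim: k m => [|k IHk] [|m]; rewrite ?gb0 ?expr0 ?mulr1 //.
  by rewrite gb0S mulr0 gb_ge0.
rewrite gbSS [leRHS]gbSS.
have -> : Q ^+ k.+1 * ((Q ^+ m.+1 - 1) / (Q ^+ k.+1 - 1) * gb m k)
   = (Q * (Q ^+ m.+1 - 1)) / (Q ^+ k.+1 - 1) * (Q ^+ k * gb m k).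
  by rewrite {1}exprS; ring.
apply: ler_pM => //.
- rewrite divr_ge0 ?mulr_ge0 //; last exact: ltW (expqB1_gt0 q1 k).
  exact: ltW (expqB1_gt0 q1 m).
- by rewrite mulr_ge0 ?gb_ge0 // ltW ?expq_gt0.
rewrite ler_pM2r ?invr_gt0 ?expqB1_gt0 // mulrBr mulr1 -exprS lerB //.
by rewrite ler1n; nat_lia.
Qed.

Lemma gb_shift m k s : Q ^+ (k * s) * gb m k <= gb (m + s) k.
Proof.
elim: s => [|s IHs]; first by rewrite muln0 expr0 mul1r addn0.
rewrite addnS; apply: le_trans (gb_shift1 _ _).
by rewrite mulnS exprD -mulrA ler_pM2l ?expq_gt0.
Qed.

Lemma gb_drop m k j : (k <= m)%N -> Q ^+ (j * (m - k)) * gb m k <= gb (m + j) (k + j).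
Proof.
move=> km; elim: j => [|j IHj]; first by rewrite mul0n expr0 mul1r !addn0.
rewrite !addnS; apply: le_trans (gbSS_ge q1 _); last by nat_lia.
have -> : (m + j - (k + j) = m - k)%N by nat_lia.
by rewrite mulSn exprD -mulrA ler_pM2l ?expq_gt0.
Qed.

Lemma pow2_expq_le c x y : (c + x <= y)%N -> 2 ^+ c * Q ^+ x <= Q ^+ y.
Proof.
move=> cxy; apply: le_trans (leq_expq q1 cxy); rewrite exprD ler_wpM2r //.
  by rewrite ltW ?expq_gt0.
by rewrite lerXn2r ?nnegrE ?ge2q // ltW ?q_gt0.
Qed.

End GaussShift.

Lemma half_exp_le t : (2 <= t)%N -> 2^-1 ^+ t <= 1 / 4 :> rat.
Proof.
move=> t2; have <- : 2^-1 ^+ 2 = 1 / 4 :> rat by rewrite expr2; field.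
by apply: ler_wiXn2l => //; lra.
Qed.

Lemma one_sub_half_exp_ge t : (2 <= t)%N -> 3 / 4 <= 1 - 2^-1 ^+ t :> rat.
Proof. by move=> /half_exp_le h; lra. Qed.

Lemma level_arith (N h s : rat) : 0 <= N -> 3 / 4 <= h -> s <= N ->
  2 * s <= 4 * (N * h).
Proof. by move=> N0 h34 sN; have := ler_wpM2l N0 h34; lra. Qed.

Section Level.
Variables (F : finFieldType) (n t i : nat).
Local Notation V := 'rV[F]_n.
Implicit Types (A B P U W X Y L T J : {vspace V}) (G : {set {vspace V}}).
Local Notation Q := (#|F|%:R : rat).
Local Notation gb := (gauss_binom #|F|).
Let q1 : (1 < #|F|)%N := finNzRing_gt1 F.
Hypotheses (t_ge2 : (2 <= t)%N) (n_ge : (5 * t + 3 <= n)%N).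
Hypotheses (ti : (t + 1 <= i)%N) (i2n : (2 * i <= n)%N).

Lemma exists_between U W k : (U <= W)%VS -> (\dim U <= k <= \dim W)%N ->
  exists P, [/\ (U <= P)%VS, (P <= W)%VS & \dim P = k].
Proof.
move=> UW /andP[Uk kW]; have : 0 < gb (\dim W - \dim U) (k - \dim U).
  by rewrite gb_gt0 // leq_sub2r.
have := card_ext_set (k - \dim U) (subvv U) UW.
rewrite subnn muln0 expr0 mul1r => <-; rewrite ltr0n => /card_gt0P[P].
by rewrite inE subnKC // => /and4P[UP PW _ /eqP dP]; exists P.
Qed.

Definition pair_layer A A' j : {set {vspace V}} :=
  [set B : {vspace V} | [&& \dim B == i, \dim (B :&: (A :&: A')) == (i - t - j)%N,
     (i - t <= \dim (B :&: A))%N & (i - t <= \dim (B :&: A'))%N]].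

(** Choose J = B :&: I, then (i-t)-spaces P <= B :&: A and P' <= B :&: A' through J. They meet I,
    and therefore each other, exactly in J, so B contains P + P' of dimension i - t + j.
    Overcounting is harmless. *)
Lemma card_pair_layer A A' j : \dim A = i -> \dim A' = i ->
  \dim (A :&: A') = (i - t)%N -> (j <= t)%N -> (j <= i - t)%N ->
  #|pair_layer A A' j|%:R <= gb (i - t) (i - t - j) *
    (Q ^+ (j * j) * gb t j * (Q ^+ (j * j) * gb t j * gb (n - (i - t + j)) (t - j))).
Proof.
move=> dA dA' dI jt jit; set I := (A :&: A')%VS.
pose layer := \bigcup_(J in [set J : {vspace V} | (J <= I)%VS && (\dim J == i - t - j)%N])
  \bigcup_(P in ext_set J I A j) \bigcup_(P' in ext_set J I A' j)
  [set B : {vspace V} | (P + P' <= B)%VS && (\dim B == i)].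
have sL : pair_layer A A' j \subset layer.
  apply/subsetP => B; rewrite inE => /and4P[/eqP dB /eqP dJ dBA dBA'].
  have sJA : (B :&: I <= B :&: A)%VS by rewrite capvS // capvSl.
  have sJA' : (B :&: I <= B :&: A')%VS by rewrite capvS // capvSr.
  have [|P [JP]] := exists_between (k := (i - t)%N) sJA; first by rewrite dJ; nat_lia.
  have [|P' [JP']] := exists_between (k := (i - t)%N) sJA'; first by rewrite dJ; nat_lia.
  rewrite !subv_cap => /andP[P'B P'A] dP' /andP[PB PA] dP.
  apply/bigcupP; exists (B :&: I)%VS; first by rewrite inE capvSr -/I dJ /=.
  apply/bigcupP; exists P.
    rewrite inE JP PA capvS // dP dJ; apply/eqP; nat_lia.
  apply/bigcupP; exists P'.
    rewrite inE JP' P'A capvS // dP' dJ; apply/eqP; nat_lia.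
  by rewrite inE subv_add PB P'B dB /=.
apply: le_trans (_ : #|layer|%:R <= _); first by rewrite ler_nat subset_leq_card.
have := card_subspaces I (i - t - j)%N; rewrite dI => <-.
apply: card_bigcup_le => J; rewrite inE => /andP[JI /eqP dJ].
have dIJ : (\dim I - \dim J = j)%N by rewrite dI dJ; nat_lia.
have IA : (I <= A)%VS by exact: capvSl.
have IA' : (I <= A')%VS by exact: capvSr.
have cE : #|ext_set J I A j|%:R = Q ^+ (j * j) * gb t j.
  by rewrite card_ext_set // dIJ dA dI (_ : (i - (i - t) = t)%N) //; nat_lia.
have cE' : #|ext_set J I A' j|%:R = Q ^+ (j * j) * gb t j.
  by rewrite card_ext_set // dIJ dA' dI (_ : (i - (i - t) = t)%N) //; nat_lia.
rewrite -{1}cE; apply: card_bigcup_le => P; rewrite inE => /and4P[JP PA PI /eqP dP].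
rewrite -cE'; apply: card_bigcup_le => P'; rewrite inE => /and4P[JP' PA' PI' /eqP dP'].
have PP' : (P :&: P' = J)%VS.
  apply/eqP; rewrite eqEsubv subv_cap JP JP' /= andbT; apply: subv_trans PI.
  rewrite subv_cap capvSl /= /I subv_cap (subv_trans (capvSl _ _) PA).
  exact: subv_trans (capvSr _ _) PA'.
have dPP : \dim (P + P') = (i - t + j)%N.
  by have := dimv_sum_cap P P'; rewrite PP' dP dP' dJ; nat_lia.
rewrite card_sup dPP; last by nat_lia.
by have -> : (i - (i - t + j) = t - j)%N by nat_lia.
Qed.

(** Raising both indices j times gains q^(n-i) each time; raising the upper index another i - t
    times gains q^t each time. *)
Let N_ge j : (j <= t)%N ->
  Q ^+ (j * (n - i) + t * (i - t)) * gb (n - (i - t + j)) (t - j) <= gb n t.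
Proof.
move=> jt; have := gb_shift q1 (n - (i - t))%N t (i - t)%N.
have -> : (n - (i - t) + (i - t) = n)%N by nat_lia.
apply: le_trans; rewrite addnC exprD -mulrA ler_pM2l ?expq_gt0 //.
have := @gb_drop _ q1 (n - (i - t + j))%N (t - j)%N j.
have -> : (n - (i - t + j) - (t - j) = n - i)%N by nat_lia.
have -> : (n - (i - t + j) + j = n - (i - t))%N by nat_lia.
have -> : (t - j + j = t)%N by nat_lia.
by apply; nat_lia.
Qed.

(** Reduces a layer to a comparison of exponents. The constants C and c stay free because no single
    choice works: (2,2) serves j = 1, (4,4) serves t >= 3, and (4,1) serves j = t = 2. *)
Lemma pair_layer_product_le a b c (C : rat) j :
  (0 < j <= t)%N -> (j <= i - t)%N -> 0 <= a -> 0 <= b ->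
  a <= C * Q ^+ (j * (i - t - j)) -> b <= c * Q ^+ (j * (t - j)) ->
  (forall e, e = (j * (i + t - j) + 3 * t)%N ->
     C * (c * c) * 2 ^+ j * Q ^+ e <= 4 * Q ^+ (j * (n - i) + t * (i - t))) ->
  a * (Q ^+ (j * j) * b * (Q ^+ (j * j) * b * gb (n - (i - t + j)) (t - j)))
  <= gb n t * (4 * Q ^- (3 * t) * 2^-1 ^+ j).
Proof.
move=> /andP[j0 jt] jit a0 b0 aC bc H.
have q0 m := expq_gt0 q1 m.
set g := gb _ (t - j); have g0 : 0 <= g by exact: gb_ge0.
have p20 : 0 < 2 ^+ j :> rat by rewrite exprn_gt0.
rewrite exprVn [leRHS]mulrA ler_pdivlMr // [leRHS]mulrA ler_pdivlMr //.
have bb : b * b <= (c * c) * (Q ^+ (j * (t - j)) * Q ^+ (j * (t - j))).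
  by rewrite mulrACA ler_pM.
have C0 : 0 <= C * Q ^+ (j * (i - t - j)) by exact: le_trans aC.
apply: (le_trans (y := (C * Q ^+ (j * (i - t - j)) *
  ((c * c) * (Q ^+ (j * (t - j)) * Q ^+ (j * (t - j))))) *
  (Q ^+ (j * j) * Q ^+ (j * j) * 2 ^+ j * Q ^+ (3 * t) * g))).
  have -> : a * (Q ^+ (j * j) * b * (Q ^+ (j * j) * b * g)) * 2 ^+ j * Q ^+ (3 * t)
    = (a * (b * b)) * (Q ^+ (j * j) * Q ^+ (j * j) * 2 ^+ j * Q ^+ (3 * t) * g) by ring.
  rewrite ler_wpM2r //; last by rewrite ler_pM ?mulr_ge0.
  by rewrite !mulr_ge0 // ltW.
have E : Q ^+ (j * (i + t - j) + 3 * t) = Q ^+ (j * (i - t - j)) *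
   (Q ^+ (j * (t - j)) * Q ^+ (j * (t - j))) * (Q ^+ (j * j) * Q ^+ (j * j)) * Q ^+ (3 * t).
  rewrite -!exprD; congr (_ ^+ _); rewrite -!mulnDr; congr (_ * _ + _)%N.
  by rewrite addnACA -!addnA; nat_lia.
have := H _ erefl; rewrite E => {}H.
apply: (le_trans (y := 4 * Q ^+ (j * (n - i) + t * (i - t)) * g)).
  apply: le_trans (ler_wpM2r g0 H); rewrite le_eqVlt; apply/orP; left; apply/eqP; ring.
by rewrite -mulrA [leRHS]mulrC ler_pM2l // /g N_ge.
Qed.

Lemma pair_layer_le A A' j : \dim A = i -> \dim A' = i ->
  \dim (A :&: A') = (i - t)%N -> (0 < j <= t)%N -> (j <= i - t)%N ->
  #|pair_layer A A' j|%:R <= gb n t * (4 * Q ^- (3 * t) * 2^-1 ^+ j).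
Proof.
move=> dA dA' dI /andP[j0 jt] jit.
apply: le_trans (card_pair_layer dA dA' dI jt jit) _.
have a0 := gb_ge0 q1 (i - t)%N (i - t - j)%N; have b0 := gb_ge0 q1 t j.
have q0 m := expq_gt0 q1 m.
have a4 : gb (i - t) (i - t - j) <= 4 * Q ^+ (j * (i - t - j)).
  have := gb_le4 q1 (leq_subr j (i - t)%N).
  by rewrite (_ : (i - t - (i - t - j) = j)%N) 1?mulnC //; nat_lia.
have jjt : (0 < j <= t)%N by rewrite j0 jt.
have [j1|j1] := eqVneq j 1%N.
  have a2 : gb (i - t) (i - t - j) <= 2 * Q ^+ (j * (i - t - j)).
    rewrite j1 mul1n; have [m ->] : exists m, (i - t = m.+1)%N.
      by exists (i - t - 1)%N; nat_lia.
    by rewrite subn1 /= gb_pred // gb1_le2.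
  have b2 : gb t j <= 2 * Q ^+ (j * (t - j)).
    rewrite j1 mul1n; have [m ->] : exists m, (t = m.+1)%N by exists (t - 1)%N; nat_lia.
    by rewrite subn1 gb1_le2.
  apply: (pair_layer_product_le jjt jit a0 b0 a2 b2) => e ->.
  have h := pow2_expq_le q1 (exponent_j1 t_ge2 ti i2n n_ge).
  rewrite j1 (_ : 2 * (2 * 2) * 2 ^+ 1 = 4 * 2 ^+ 2); last by ring.
  by rewrite -mulrA ler_pM2l.
have j2 : (2 <= j)%N by rewrite ltn_neqAle eq_sym j1.
have [t3|t3] := leqP 3 t.
  have b4 : gb t j <= 4 * Q ^+ (j * (t - j)) by exact: gb_le4.
  apply: (pair_layer_product_le jjt jit a0 b0 a4 b4) => e ->.
  have j2t : (2 <= j <= t)%N by rewrite j2.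
  have h := pow2_expq_le q1 (exponent_j t3 j2t ti i2n n_ge).
  (* Source of the summand j + 4 in [exponent_j]. *)
  rewrite (_ : 4 * (4 * 4) * 2 ^+ j = 4 * 2 ^+ (j + 4)); last first.
    by rewrite exprD; set x := 2 ^+ j; ring.
  by rewrite -mulrA ler_pM2l.
(* The constant 4 for [t,j] is too expensive here, for instance at n = 13 and i = 6, but [2,2] = 1
   is exact. *)
have t2 : t = 2%N by nat_lia.
have jE : j = t by nat_lia.
have b1 : gb t j <= 1 * Q ^+ (j * (t - j)).
  by rewrite jE gbnn // subnn muln0 expr0 mulr1.
apply: (pair_layer_product_le jjt jit a0 b0 a4 b1) => e ->.
rewrite !mulr1 -mulrA ler_pM2l // pow2_expq_le //.
by nat_lia.
Qed.

Theorem level_bound G :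
  (forall B, B \in G -> \dim B = i) ->
  (forall A B, A \in G -> B \in G -> (i - t <= \dim (A :&: B))%N) ->
  #|G|%:R <= gb n t * (Q ^- (t * (i - t)) + 4 * Q ^- (3 * t) * (1 - 2^-1 ^+ t)).
Proof.
move=> Gd Gi; have q0 m := expq_gt0 q1 m.
have N0 : 0 < gb n t by rewrite gb_gt0 //; nat_lia.
have half0 : 0 <= 1 - 2^-1 ^+ t :> rat.
  by rewrite subr_ge0 (le_trans (half_exp_le t_ge2)).
have [/existsP[A /existsP[A' /and3P[AG AG' /eqP dI]]]|] :=
  boolP [exists A, exists A', [&& A \in G, A' \in G & \dim (A :&: A') == (i - t)%N]].
  have dA := Gd _ AG; have dA' := Gd _ AG'.
  have sG : G \subset \bigcup_(j < t.+1 | (j <= i - t)%N) pair_layer A A' j.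
    apply/subsetP => B BG.
    have le_it : (\dim (B :&: (A :&: A')) <= i - t)%N by rewrite -dI dimvS // capvSr.
    have hA := Gi _ _ BG AG; have hA' := Gi _ _ BG AG'.
    (* Both B :&: A and B :&: A' have dimension at least i - t inside B, so they share at least i -
       2t dimensions. *)
    have jt : (i - t - \dim (B :&: (A :&: A')) < t.+1)%N.
      have := dimv_sum_cap (B :&: A) (B :&: A').
      have : (B :&: A + B :&: A' <= B)%VS by rewrite subv_add !capvSl.
      move/dimvS; rewrite (Gd _ BG).
      have -> : (B :&: A :&: (B :&: A') = B :&: (A :&: A'))%VS.
        by apply/vspaceP => v; rewrite !memv_cap; case: (v \in B); case: (v \in A).
      by nat_lia.
    apply/bigcupP; exists (Ordinal jt) => /=; first by nat_lia.
    by rewrite inE (Gd _ BG) hA hA' eqxx !andbT /=; apply/eqP; nat_lia.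
  apply: (le_trans (y := \sum_(j < t.+1 | (j <= i - t)%N) #|pair_layer A A' j|%:R)).
    rewrite -natr_sum ler_nat; apply: leq_trans (subset_leq_card sG) _.
    elim/big_rec2: _ => [|x m C _ IH]; first by rewrite cards0.
    by apply: leq_trans (leq_card_setU _ _).1 _; rewrite leq_add2l.
  (* The layer j = 0 is the main term; the weights of the others sum to 2^-1 + ... + 2^-t = 1 -
     2^-t. *)
  rewrite big_mkcond big_ord_recl /= mulrDr lerD //.
    apply: le_trans (card_pair_layer dA dA' dI _ _) _ => //.
    rewrite subn0 mul0n expr0 !gb0 gbnn // !mul1r addn0 subn0.
    by rewrite ler_pdivlMr // mulrC; have := N_ge (leq0n t); rewrite mul0n add0n addn0 subn0.
  have -> : 1 - 2^-1 ^+ t = \sum_(j < t) 2^-1 ^+ (lift ord0 j) :> rat.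
    elim: (t) => [|m IHm]; first by rewrite big_ord0 expr0 subrr.
    by rewrite big_ord_recr /= -IHm /bump /= add1n exprS; field.
  rewrite !mulr_sumr; apply: ler_sum => j _; case: ifP => jit.
    by apply: pair_layer_le => //=; rewrite /bump /= add1n.
  by rewrite !mulr_ge0 ?invr_ge0 ?exprn_ge0 ?(ltW N0).
(* Without a pair meeting in dimension i - t, every member shares an (i-t+1)-space with a fixed A,
   and the error term alone suffices. *)
rewrite negb_exists => /forallP nE.
have Gi' A B : A \in G -> B \in G -> (i - t + 1 <= \dim (A :&: B))%N.
  move=> AG BG; have := nE A; rewrite negb_exists => /forallP/(_ B).
  by rewrite AG BG /=; have := Gi A B AG BG; move=> h /eqP; clear -h; lia.
have [->|[A AG]] := set_0Vmem G.
  by rewrite cards0 mulr_ge0 ?addr_ge0 ?mulr_ge0 ?invr_ge0 ?exprn_ge0 ?(ltW N0).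
pose cov := \bigcup_(L in [set L : {vspace V} | (L <= A)%VS && (\dim L == i - t + 1)%N])
    [set B : {vspace V} | (L <= B)%VS && (\dim B == i)].
have sG : G \subset cov.
  apply/subsetP => B BG; have [L sL dL] := exists_dim (Gi' _ _ AG BG).
  move: sL; rewrite subv_cap => /andP[LA LB].
  apply/bigcupP; exists L; first by rewrite inE LA dL /=.
  by rewrite inE LB Gd /=.
apply: (le_trans (y := gb i (i - t + 1) * gb (n - (i - t + 1)) (t - 1))).
  apply: (le_trans (y := #|cov|%:R)); first by rewrite ler_nat subset_leq_card.
  have := card_subspaces A (i - t + 1)%N; rewrite (Gd _ AG) => <-.
  apply: card_bigcup_le => L.
  rewrite inE => /andP[_ /eqP dL]; rewrite card_sup dL; last by nat_lia.
  by have -> : (i - (i - t + 1) = t - 1)%N by nat_lia.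
apply: (le_trans (y := gb n t * (4 * Q ^- (3 * t) * (1 - 2^-1 ^+ t)))); last first.
  by rewrite ler_pM2l // lerDr invr_ge0 ltW.
have h34 := one_sub_half_exp_ge t_ge2.
have hN := N_ge (ltnW t_ge2).
have h4 : gb i (i - t + 1) <= 4 * Q ^+ ((i - t + 1) * (t - 1)).
  have := @gb_le4 _ q1 i (i - t + 1)%N.
  by rewrite (_ : (i - (i - t + 1) = t - 1)%N); [apply; nat_lia|nat_lia].
set g := gb (n - _) _ in hN *; have g0 : 0 <= g by exact: gb_ge0.
apply: (le_trans (y := 4 * Q ^+ ((i - t + 1) * (t - 1)) * g)).
  by rewrite ler_wpM2r.
have hE : 2 ^+ 1 * Q ^+ ((i - t + 1) * (t - 1) + 3 * t) <= Q ^+ (1 * (n - i) + t * (i - t)).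
  exact: (pow2_expq_le q1 (exponent_near t_ge2 ti i2n n_ge)).
have {hE} := ler_wpM2r g0 hE.
rewrite expr1 exprD; set a := Q ^+ (_ * (t - 1)); set b := Q ^+ (3 * t).
have b0 : 0 < b by exact: q0.
have a0 : 0 < a by exact: q0.
set h := 1 - _ in half0 h34 *; set R := _ ^+ (_ + _) * g in hN *.
move=> hE; have hEN := le_trans hE hN.
have -> : gb n t * (4 / b * h) = (4 * (gb n t * h)) / b by ring.
rewrite ler_pdivlMr //.
apply: le_trans (level_arith (ltW N0) h34 hEN); rewrite le_eqVlt.
by apply/orP; left; apply/eqP; ring.
Qed.

End Level.

(** * Duality *)

Section Duality.
Variables (F : finFieldType) (n : nat).
Local Notation V := 'rV[F]_n.
Implicit Types (A B U W X Y : {vspace V}).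

Section Form.
Variable form : {biscalar V}.

(** Valued in [F^o], so that rank-nullity applies to it as a map between vector spaces. *)
Definition form_at (u v : V) : F^o := form u v.

Lemma form_at_linear u : linear (form_at u).
Proof. by move=> a x y; rewrite /form_at linearPr. Qed.

HB.instance Definition _ u :=
  GRing.isLinear.Build F V F^o *:%R (form_at u) (form_at_linear u).

Lemma perp_add U W : perp form (U + W) = (perp form U :&: perp form W)%VS.
Proof.
apply/vspaceP => v; rewrite memv_cap; apply/mem_perp/andP => [H|[/mem_perp HU /mem_perp HW]].
  split; apply/mem_perp => u uU; apply: H.
    by apply: (subvP (addvSl U W)).
  by apply: (subvP (addvSr U W)).
move=> u /memv_addP[x xU [y yW ->]].
by rewrite linearDl /= HU // HW // addr0.
Qed.

Lemma perp0 : perp form 0 = fullv.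
Proof.
apply/vspaceP => v; rewrite memvf; apply/mem_perp => u; rewrite memv0 => /eqP->.
exact: linear0l.
Qed.

Lemma dim_perp_add_line U w : (\dim (perp form U) <= (\dim (perp form (U + <[w]>))).+1)%N.
Proof.
rewrite -(limg_ker_dim (linfun (form_at w)) (perp form U)).
have h1 : (\dim (linfun (form_at w) @: perp form U) <= 1)%N.
  by apply: leq_trans (dimvS (subvf _)) _; rewrite dimvf.
have h2 : (\dim (perp form U :&: lker (linfun (form_at w)))
           <= \dim (perp form (U + <[w]>)))%N.
  rewrite dimvS // perp_add capvS //; apply/subvP => v.
  rewrite memv_ker lfunE /= => /eqP wv; apply/mem_perp => u /vlineP[c ->].
  by rewrite linearZl_LR /= -/(form_at w v) wv mulr0.
by apply: leq_trans (leq_add h2 h1) _; rewrite addn1.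
Qed.

Lemma dim_perp_span (s : seq V) U :
  (\dim (perp form U) <= \dim (perp form (U + <<s>>)) + size s)%N.
Proof.
elim: s U => [|w s IHs] U; first by rewrite span_nil addv0 addn0.
rewrite span_cons addvA /= addnS; apply: leq_trans (dim_perp_add_line U w) _.
by rewrite ltnS IHs.
Qed.

Hypothesis nondeg : nondegenerate_form form.

Lemma perp_full : perp form fullv = 0%VS.
Proof.
apply/eqP; rewrite -subv0; apply/subvP => v /mem_perp H; rewrite memv0; apply/eqP.
by apply: nondeg.2 => u; apply: H; rewrite memvf.
Qed.

(* Adding a vector to U lowers the dimension of the perp by at most one, and n steps
   lead from perp 0 = V to perp V = 0, so every step lowers it by exactly one. *)
Lemma dim_perp U : \dim (perp form U) = (n - \dim U)%N.
Proof.
have h1 := dim_perp_span (vbasis U) 0.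
rewrite add0v (span_basis (vbasisP U)) perp0 dim_full size_tuple in h1.
have h2 := dim_perp_span (vbasis U^C) U.
rewrite (span_basis (vbasisP _)) addv_complf perp_full dimv0 size_tuple in h2.
rewrite dimv_compl dim_full in h2.
by have := dim_le U; nat_lia.
Qed.

Lemma perp_inj : injective (perp form).
Proof.
move=> U W e; have d : \dim U = \dim W :> nat.
  have := dim_perp U; rewrite e dim_perp; have := dim_le U; have := dim_le W.
  by nat_lia.
have dUW : \dim (U + W) = \dim U :> nat.
  have := dim_perp (U + W); rewrite perp_add e capvv dim_perp.
  have := dim_le U; have := dim_le W; have := dim_le (U + W).
  by nat_lia.
have /eqP E1 : U == (U + W)%VS by rewrite eqEdim addvSl dUW /=.
have /eqP E2 : W == (U + W)%VS by rewrite eqEdim addvSr dUW d /=.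
by rewrite E1 -E2.
Qed.

Lemma perp_sub U W : (perp form W <= perp form U)%VS = (U <= W)%VS.
Proof.
apply/idP/idP => [/capv_idPr|UW]; last first.
  by apply/subvP => v /mem_perp H; apply/mem_perp => u uU; apply: H; apply: (subvP UW).
by rewrite -perp_add => /perp_inj <-; rewrite addvSl.
Qed.

Lemma perp_surj W : exists U, perp form U = W.
Proof. by have [g _ gK] := injF_bij perp_inj; exists (g W). Qed.

Lemma dim_perp_cap U W :
  \dim (perp form U :&: perp form W) = (n - \dim (U + W))%N.
Proof. by rewrite -perp_add dim_perp. Qed.

Lemma subspace_dist_perp U W :
  subspace_dist (perp form U) (perp form W) = subspace_dist U W.
Proof.
rewrite /subspace_dist dim_perp_cap.
have := dimv_sum_cap (perp form U) (perp form W); rewrite dim_perp_cap !dim_perp.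
have := dimv_sum_cap U W.
have := dim_le U; have := dim_le W; have := dim_le (U + W).
by nat_lia.
Qed.

Lemma card_perp_family (S : {set {vspace V}}) : #|perp_family form S| = #|S|.
Proof. by rewrite card_imset //; exact: perp_inj. Qed.

End Form.
End Duality.

(** * Families of bounded diameter *)

Section LowLevels.
Variables (F : finFieldType) (n : nat).
Local Notation V := 'rV[F]_n.
Local Notation gb := (gauss_binom #|F|).

Definition low_levels m : {set {vspace V}} := \bigcup_(i < m) grassmannian F n i.

Lemma mem_low_levels m (B : {vspace V}) : (B \in low_levels m) = (\dim B < m)%N.
Proof.
apply/bigcupP/idP => [[i _]|lt]; first by rewrite inE => /eqP->.
by exists (Ordinal lt); rewrite ?inE.
Qed.

Lemma card_low_levels m : #|low_levels m|%:R = \sum_(i < m) gb n i.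
Proof.
elim: m => [|m IHm]; first by rewrite /low_levels !big_ord0 cards0.
rewrite big_ord_recr /= -IHm -card_grassmannian; apply: card_setU_disjoint => [|B].
  by apply/setP => B; rewrite in_setU !mem_low_levels inE ltnS leq_eqVlt orbC.
by rewrite mem_low_levels inE => lt; rewrite neq_ltn lt.
Qed.

Lemma card_low_HM m (H : {set {vspace V}}) :
  (forall B, B \in H -> \dim B = m) ->
  #|low_levels m :|: H|%:R = \sum_(i < m) gb n i + #|H|%:R.
Proof.
move=> Hd; rewrite -card_low_levels; apply: card_setU_disjoint => // B.
by rewrite mem_low_levels => lt; apply/negP => /Hd e; rewrite e ltnn in lt.
Qed.

Lemma stability_boundE (q t : nat) :
  stability_bound q n t = \sum_(i < t + 1) gauss_binom q n i + hm_bound q n t.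
Proof. by rewrite addn1 /stability_bound /hm_bound !addrA. Qed.

Lemma HM_family_dim k (X Y B : {vspace V}) : B \in HM_family k X Y -> \dim B = k.
Proof. by rewrite !inE => /orP[] /andP[/eqP]. Qed.

Lemma card_K_family t (X Y : {vspace V}) : (2 <= t)%N -> \dim X = 1%N -> \dim Y = (t + 1)%N ->
  ~~ (X <= Y)%VS -> #|K_family (t + 1) X Y|%:R = stability_bound #|F| n t.
Proof.
move=> t2 dX dY XY; rewrite stability_boundE -(card_HM_family_dim1 (ltnW t2) dX dY XY).
by apply: card_low_HM => B; exact: HM_family_dim.
Qed.

Lemma card_Kstar_family (Y : {vspace V}) : (4 <= n)%N -> \dim Y = 3%N ->
  #|Kstar_family Y|%:R = stability_bound #|F| n 2.
Proof.
move=> n4 dY; rewrite stability_boundE -(card_HMstar_family dY n4).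
by apply: card_low_HM => B; rewrite !inE => /andP[/eqP].
Qed.

End LowLevels.

(** The terms are the extra cost of dimension t+1, the 2t+2 levels above t, and dimension t. For t
    >= 3, 2t + 2 <= 2^t tames the middle one. For q = t = 2 the estimate is 31/32, and dropping the
    factor 1 - 2^-t would push it above 1. *)
Lemma level_sum_arith (q t : nat) : (1 < q)%N -> (2 <= t)%N ->
  q%:R ^- t + (2 * t + 2)%:R *
    (q%:R ^- (2 * t) + 4 * q%:R ^- (3 * t) * (1 - 2^-1 ^+ t)) + q%:R ^- (t + 2)
  < 1 :> rat.
Proof.
move=> q1 t2; have hq := ge2q q1; set Q : rat := q%:R in hq *.
have q0 m : 0 < Q ^+ m := expq_gt0 q1 m.
set z := Q ^- t; have z0 : 0 < z by rewrite invr_gt0.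
have zt : z <= 2^-1 ^+ t.
  by rewrite /z exprVn lef_pV2 ?posrE ?q0 ?exprn_gt0 // lerXn2r ?nnegrE.
have -> : Q ^- (2 * t) = z ^+ 2 by rewrite mulnC exprM exprVn.
have -> : Q ^- (3 * t) = z ^+ 3 by rewrite mulnC exprM exprVn.
have h4 : Q ^- (t + 2) <= z / 4.
  rewrite exprD invfM ler_pM2l // lef_pV2 ?posrE ?exprn_gt0 //; last by lra.
  by rewrite expr2; nra.
have [t3|t3] := leqP 3 t.
  have tz : (2 * t + 2)%:R * z <= 1.
    apply: (le_trans (y := (2 * t + 2)%:R * 2^-1 ^+ t)); first by rewrite ler_wpM2l.
    rewrite exprVn ler_pdivrMr ?exprn_gt0 // mul1r -natrX ler_nat.
    clear -t3; elim: t t3 => // t IHt; rewrite leq_eqVlt => /predU1P[<- //|].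
    by rewrite ltnS => /IHt; rewrite expnS; lia.
  have z8 : z <= 1 / 8.
    have <- : 2^-1 ^+ 3 = 1 / 8 :> rat by rewrite !exprS expr0; field.
    by apply: le_trans zt _; apply: ler_wiXn2l => //; lra.
  have h : z ^+ 2 + 4 * z ^+ 3 * (1 - 2^-1 ^+ t) <= z * (z + 4 * z ^+ 2).
    have : 0 <= 4 * z ^+ 3 * 2^-1 ^+ t by rewrite !mulr_ge0 ?exprn_ge0 // ltW.
    by rewrite !exprS expr0; lra.
  have {}h := ler_wpM2l (ler0n _ (2 * t + 2)) h.
  have : (2 * t + 2)%:R * (z * (z + 4 * z ^+ 2)) <= z + 4 * z ^+ 2.
    by rewrite mulrA ler_piMl // addr_ge0 ?mulr_ge0 ?exprn_ge0 // ltW.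
  have : z ^+ 2 <= z / 8 by rewrite expr2 ler_pM2l // (le_trans z8).
  by move: h h4; clear -z8 z0; set X := _ * (_ + _); set Y := _ * _; lra.
have t2' : t = 2%N by nat_lia.
have z4 : z <= 1 / 4 := le_trans zt (half_exp_le t2).
rewrite t2' in h4 *.
have -> : (2 * 2 + 2)%:R = 6 :> rat by [].
have -> : 1 - 2^-1 ^+ 2 = 3 / 4 :> rat by rewrite expr2; field.
have h2 : z ^+ 2 <= 1 / 16 by rewrite expr2; nra.
have h3 : z ^+ 3 <= 1 / 64 by rewrite exprS; nra.
by move: h2 h3 h4; clear -z4 z0; lra.
Qed.

(** * Families whose extreme dimensions add up to at most n *)

Section OneSided.
Variables (F : finFieldType) (n t : nat) (form : {biscalar 'rV[F]_n}).
Local Notation V := 'rV[F]_n.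
Implicit Types (A B U W X Y : {vspace V}).
Local Notation Q := (#|F|%:R : rat).
Local Notation gb := (gauss_binom #|F|).
Hypotheses (t_ge2 : (2 <= t)%N) (n_ge : (5 * t + 3 <= n)%N).
Hypothesis nondeg : nondegenerate_form form.
Variable Fam : {set {vspace V}}.
Hypothesis Fam_dist : forall A B, A \in Fam -> B \in Fam ->
  (subspace_dist A B <= 2 * t + 1)%N.
Let q1 : (1 < #|F|)%N := finNzRing_gt1 F.

Definition level i : {set {vspace V}} := [set B in Fam | \dim B == i].

(** For two members of dimension i, parity sharpens this to i - t <= dim (A :&: B); for i = t + 1
    they intersect. *)
Lemma Fam_cap A B : A \in Fam -> B \in Fam ->
  (\dim A + \dim B <= 2 * t + 1 + 2 * \dim (A :&: B))%N.
Proof.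
move=> AF BF; have := Fam_dist AF BF; rewrite /subspace_dist.
by have := dimv_sum_cap A B; nat_lia.
Qed.

Lemma hm_bound_ge0 : 0 <= hm_bound #|F| n t.
Proof.
have [|Y _ dY] := @exists_dim F n fullv (t + 1); first by rewrite dim_full; nat_lia.
have /subvPn[e _ eY] : ~~ (fullv <= Y)%VS.
  by apply/negP => /dimvS; rewrite dim_full dY; nat_lia.
by rewrite -(card_HM_family _ dY eY) //; nat_lia.
Qed.

Lemma low_dim_case :
  (forall B, B \in Fam -> (\dim B <= t + 1)%N) ->
  (forall X, \dim X = 1%N -> ~~ (Fam \subset D_family t X)) ->
  #|Fam|%:R <= stability_bound #|F| n t /\
  (#|Fam|%:R = stability_bound #|F| n t ->
     (exists X Y, [/\ \dim X = 1%N, \dim Y = (t + 1)%N, ~~ (X <= Y)%VS &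
                      Fam = K_family (t + 1) X Y]) \/
     (t = 2%N /\ exists2 Y, \dim Y = 3%N & Fam = Kstar_family Y)).
Proof.
move=> Fd FD; pose G := level (t + 1).
have FE : Fam = (Fam :&: low_levels F n (t + 1)) :|: G.
  apply/setP => B; rewrite !inE mem_low_levels; case BF: (B \in Fam) => //=.
  by have := Fd B BF; rewrite leq_eqVlt orbC.
have cF : #|Fam|%:R = #|Fam :&: low_levels F n (t + 1)|%:R + #|G|%:R :> rat.
  apply: card_setU_disjoint FE _ => B; rewrite !inE mem_low_levels => /andP[_ lt].
  by rewrite (ltn_eqF lt) andbF.
have Gd B : B \in G -> \dim B = (t + 1)%N by rewrite inE => /andP[_ /eqP].
have Gi A B : A \in G -> B \in G -> (A :&: B)%VS != 0%VS.
  move=> AG BG; have dA := Gd _ AG; have dB := Gd _ BG.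
  move: AG BG; rewrite !inE => /andP[AF _] /andP[BF _].
  by have := Fam_cap AF BF; rewrite -dimv_eq0 -lt0n dA dB; nat_lia.
have Gt X : \dim X = 1%N -> exists2 A, A \in G & ~~ (X <= A)%VS.
  move=> dX; have /subsetPn[A AF] := FD X dX.
  have -> : (A \in D_family t X) = (A \in low_levels F n t.+1) ||
      ((\dim A == t.+1) && (X <= A)%VS) by rewrite !inE.
  rewrite mem_low_levels negb_or => /andP[ltA]; rewrite negb_and => XA.
  have dA : \dim A = (t + 1)%N by have := Fd A AF; rewrite -leqNgt in ltA; nat_lia.
  by exists A; [rewrite inE AF dA /=|move: XA; rewrite dA addn1 eqxx].
have [Gle Geq] := hilton_milner t_ge2 n_ge Gd Gi Gt.
have lowle : #|Fam :&: low_levels F n (t + 1)|%:R <= #|low_levels F n (t + 1)|%:R :> rat.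
  by rewrite ler_nat subset_leq_card // subsetIr.
rewrite stability_boundE -card_low_levels cF; split; first exact: lerD.
move=> e.
have eG : #|G|%:R = hm_bound #|F| n t.
  by apply/eqP; rewrite eq_le Gle -(lerD2l #|Fam :&: low_levels F n (t + 1)|%:R) e lerD2r.
have eL : Fam :&: low_levels F n (t + 1) = low_levels F n (t + 1).
  apply/eqP; rewrite eqEcard subsetIr /=; move: e; rewrite eG => /addIr/eqP.
  by rewrite eqr_nat => /eqP->.
case: (Geq eG) => [[X [Y [dX dY XY GE]]]|[t2 [Y dY GE]]].
  by left; exists X, Y; split=> //; rewrite FE eL GE.
by right; split=> //; exists Y => //; rewrite FE eL GE t2.
Qed.

(** If 2i > n, [level_bound] is applied to the perps, of dimension n - i; the upper bound on i keeps
    n - i at least t + 2. *)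
Lemma level_le i : (t + 2 <= i)%N -> (2 * i <= n + 2 * t + 1)%N ->
  #|level i|%:R <= gb n t * (Q ^- (2 * t) + 4 * Q ^- (3 * t) * (1 - 2^-1 ^+ t)).
Proof.
have N0 : 0 <= gb n t by exact: gb_ge0.
have mono j : (t + 2 <= j)%N -> Q ^- (t * (j - t)) <= Q ^- (2 * t).
  move=> tj; rewrite lef_pV2 ?posrE ?expq_gt0 // leq_expq // mulnC leq_mul2l.
  by apply/orP; right; nat_lia.
have Ld A : A \in level i -> \dim A = i by rewrite inE => /andP[_ /eqP].
have Li A B : A \in level i -> B \in level i -> (i - t <= \dim (A :&: B))%N.
  move=> AL BL; have dA := Ld _ AL; have dB := Ld _ BL.
  move: AL BL; rewrite !inE => /andP[AF _] /andP[BF _].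
  by have := Fam_cap AF BF; rewrite dA dB; nat_lia.
move=> ti in2; have [i2|i2] := leqP (2 * i) n.
  apply: le_trans (level_bound t_ge2 n_ge _ i2 Ld Li) _; first by nat_lia.
  by rewrite ler_wpM2l // lerD2r mono.
rewrite -(card_perp_family nondeg).
have i'2 : (2 * (n - i) <= n)%N by nat_lia.
have ti' : (t + 2 <= n - i)%N by nat_lia.
apply: le_trans (level_bound t_ge2 n_ge _ i'2 _ _) _; first by nat_lia.
- by move=> _ /imsetP[A AL ->]; rewrite dim_perp // (Ld _ AL).
- move=> _ _ /imsetP[A AL ->] /imsetP[B BL ->]; rewrite dim_perp_cap //.
  have := Li _ _ AL BL; have := dimv_sum_cap A B; rewrite (Ld _ AL) (Ld _ BL).
  by have := dim_le (A + B); nat_lia.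
by rewrite ler_wpM2l // lerD2r mono.
Qed.

Lemma level_t1_le : #|level (t + 1)|%:R
  <= gb n t * (Q ^- t + 4 * Q ^- (3 * t) * (1 - 2^-1 ^+ t)).
Proof.
have Ld A : A \in level (t + 1) -> \dim A = (t + 1)%N by rewrite inE => /andP[_ /eqP].
have i2 : (2 * (t + 1) <= n)%N by nat_lia.
have := level_bound t_ge2 n_ge (leqnn _) i2 Ld.
have -> : (t * (t + 1 - t) = t)%N by rewrite addKn muln1.
apply=> A B AL BL; have dA := Ld _ AL; have dB := Ld _ BL.
move: AL BL; rewrite !inE => /andP[AF _] /andP[BF _].
by have := Fam_cap AF BF; rewrite dA dB; nat_lia.
Qed.

(** Every t-dimensional member meets [B0], whose dimension is at most 3t + 1 as soon as there is
    such a member. *)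
Lemma level_t_le B0 : B0 \in Fam -> (t + 2 <= \dim B0)%N ->
  #|level t|%:R <= gb n t * Q ^- (t + 2).
Proof.
move=> BF dB.
have N0 : 0 <= gb n t by exact: gb_ge0.
have [->|[C0]] := set_0Vmem (level t).
  by rewrite cards0 mulr_ge0 // invr_ge0 ltW ?expq_gt0.
rewrite inE => /andP[C0F /eqP dC0].
have dB3 : (\dim B0 <= 3 * t + 1)%N.
  have := Fam_cap BF C0F; have := dimvS (capvSr B0 C0); rewrite dC0; nat_lia.
apply: (le_trans (y := gb (\dim B0) 1 * gb (n - 1) (t - 1))).
  apply: cover_bound_const => [C|v vB v0].
    rewrite inE => /andP[CF /eqP dC]; rewrite -dimv_eq0 -lt0n.
    by have := Fam_cap CF BF; rewrite dC; nat_lia.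
  have dv : \dim <[v]> = 1%N by rewrite dim_vline v0.
  have := @card_le_sup _ _ (star_at (level t) v) <[v]>%VS t.
  rewrite dv; apply=> [|C]; first by nat_lia.
  by rewrite !inE => /andP[/andP[_ /eqP dC] vC]; rewrite -memvE.
rewrite ler_pdivlMr ?expq_gt0 //.
have hN : Q ^+ (n - t) * gb (n - 1) (t - 1) <= gb n t.
  have := @gbSS_ge _ (n - 1)%N (t - 1)%N q1.
  have -> : ((n - 1).+1 = n)%N by nat_lia.
  have -> : ((t - 1).+1 = t)%N by nat_lia.
  have -> : (n - 1 - (t - 1) = n - t)%N by nat_lia.
  by apply; nat_lia.
apply: le_trans hN; rewrite mulrAC ler_wpM2r ?gb_ge0 //.
apply: (le_trans (y := Q ^+ (3 * t + 1) * Q ^+ (t + 2))).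
  apply: ler_wpM2r; first exact: ltW (expq_gt0 q1 _).
  apply: le_trans (gb1_le q1 _) _.
  exact: leq_expq.
by rewrite -exprD leq_expq //; nat_lia.
Qed.

Lemma high_dim_case A0 B0 :
  A0 \in Fam ->
  (forall B, B \in Fam -> (\dim A0 <= \dim B)%N /\ (\dim A0 + \dim B <= n)%N) ->
  B0 \in Fam -> (t + 2 <= \dim B0)%N ->
  #|Fam|%:R < stability_bound #|F| n t.
Proof.
move=> A0F minA BF dB0.
have N0 : 0 < gb n t by rewrite gb_gt0 //; nat_lia.
(* No dimension exceeds dim [A0] by more than 2t + 1, so the dimensions above t lie among 2t + 2
   values starting at [lo]. Only the first can equal t + 1, where the weaker term q^-t occurs. *)
pose lo := maxn (\dim A0) (t + 1).
have spread B : B \in Fam -> (\dim B <= \dim A0 + 2 * t + 1)%N.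
  move=> BF'; have := Fam_cap A0F BF'; have := dimvS (capvSl A0 B); nat_lia.
have sF : Fam \subset low_levels F n t :|: level t :|:
    \bigcup_(s < (2 * t + 2)%N) level (lo + s)%N.
  apply/subsetP => B BF'; rewrite !in_setU mem_low_levels inE BF' /=.
  have [lt|lt|_] := ltngtP (\dim B) t; rewrite ?orbT //=.
  have [le _] := minA _ BF'; have := spread _ BF'.
  have lo1 : (lo <= \dim B)%N by rewrite geq_max le addn1.
  have lo2 : (\dim A0 <= lo)%N by exact: leq_maxl.
  move=> hs; have hs' : (\dim B - lo < 2 * t + 2)%N by nat_lia.
  by apply/bigcupP; exists (Ordinal hs') => //; rewrite inE BF' /= subnKC.
pose eps := 4 * Q ^- (3 * t) * (1 - 2^-1 ^+ t).
have eps0 : 0 <= eps.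
  by rewrite !mulr_ge0 ?invr_ge0 ?subr_ge0 ?exprn_ile1 // ltW ?expq_gt0.
have qi0 m : 0 <= Q ^- m by rewrite invr_ge0 ltW ?expq_gt0.
have lev i : (t + 2 <= i)%N -> #|level i|%:R <= gb n t * (Q ^- (2 * t) + eps).
  move=> ti; have [->|[B]] := set_0Vmem (level i).
    by rewrite cards0 mulr_ge0 ?addr_ge0 // ltW.
  rewrite inE => /andP[BF' /eqP dB]; apply: level_le => //.
  by have [_] := minA _ BF'; have := spread _ BF'; rewrite dB; nat_lia.
have lo_ge : (t + 1 <= lo)%N by exact: leq_maxr.
have hlev : (\sum_(s < (2 * t + 2)%N) #|level (lo + s)%N|)%:R
    <= gb n t * (Q ^- t + (2 * t + 2)%:R * (Q ^- (2 * t) + eps)).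
  have -> : (2 * t + 2 = (2 * t + 1).+1)%N by nat_lia.
  rewrite big_ord_recl /= natrD addn0.
  have -> : (2 * t + 1).+1%:R = 1 + (2 * t + 1)%:R :> rat by rewrite -natr1 addrC.
  rewrite mulrDl mul1r addrA mulrDr lerD //.
    have [e|ne] := eqVneq lo (t + 1)%N.
      rewrite e; apply: le_trans level_t1_le _; rewrite ler_pM2l //.
      by rewrite -/eps lerD2l lerDr.
    apply: le_trans (lev _ _) _; first by move/eqP: ne; nat_lia.
    by rewrite ler_pM2l // lerDr.
  rewrite natr_sum mulrCA mulr_natl.
  rewrite -[in leRHS](card_ord (2 * t + 1)) -sumr_const.
  by apply: ler_sum => s _; apply: lev; rewrite /bump /=; nat_lia.
have := subset_leq_card sF; rewrite -(ler_nat rat) => /le_lt_trans; apply.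
apply: (le_lt_trans (y := \sum_(i < t) gb n i + (gb n t * Q ^- (t + 2) +
   gb n t * (Q ^- t + (2 * t + 2)%:R * (Q ^- (2 * t) + eps))))).
  rewrite addrA.
  apply: le_trans (_ : (#|low_levels F n t :|: level t| +
     #|\bigcup_(s < (2 * t + 2)%N) level (lo + s)%N|)%:R <= _).
    by rewrite ler_nat (leq_card_setU _ _).1.
  rewrite natrD; apply: lerD.
    apply: le_trans (_ : (#|low_levels F n t| + #|level t|)%:R <= _).
      by rewrite ler_nat (leq_card_setU _ _).1.
    by rewrite natrD card_low_levels lerD2l (level_t_le BF dB0).
  apply: le_trans hlev; rewrite ler_nat.
  elim/big_rec2: _ => [|x m C _ IH]; first by rewrite cards0.
  by apply: leq_trans (leq_card_setU _ _).1 _; rewrite leq_add2l.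
rewrite stability_boundE addn1 big_ord_recr /= -addrA ltrD2l.
apply: (lt_le_trans (y := gb n t)); last by rewrite lerDl hm_bound_ge0.
rewrite -mulrDr -[ltRHS]mulr1 ltr_pM2l // addrC.
exact: level_sum_arith.
Qed.

Lemma one_sided_bound :
  (forall X, \dim X = 1%N -> ~~ (Fam \subset D_family t X)) ->
  (exists2 A0, A0 \in Fam & forall B, B \in Fam ->
     (\dim A0 <= \dim B)%N /\ (\dim A0 + \dim B <= n)%N) ->
  #|Fam|%:R <= stability_bound #|F| n t /\
  (#|Fam|%:R = stability_bound #|F| n t ->
     (exists X Y, [/\ \dim X = 1%N, \dim Y = (t + 1)%N, ~~ (X <= Y)%VS &
                      Fam = K_family (t + 1) X Y]) \/
     (t = 2%N /\ exists2 Y, \dim Y = 3%N & Fam = Kstar_family Y)).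
Proof.
move=> FD [A0 A0F minA].
have [/existsP[B0 /andP[BF dB]]|] := boolP [exists B in Fam, (t + 2 <= \dim B)%N].
  have lt := high_dim_case A0F minA BF dB.
  by split; [exact: ltW|move=> e; rewrite e ltxx in lt].
rewrite negb_exists => /forallP H; apply: low_dim_case => // B BF.
by have := H B; rewrite BF -ltnNge addn2 ltnS addn1.
Qed.

End OneSided.

Lemma D_family_balls (F : finFieldType) (n t : nat) (X : {vspace 'rV[F]_n}) :
  \dim X = 1%N -> D_family t X \subset ball 0 t :|: ball X t.
Proof.
move=> dX; apply/subsetP => A.
have -> : (A \in D_family t X) = (A \in low_levels F n t.+1) ||
    ((\dim A == t.+1) && (X <= A)%VS) by rewrite !inE.
rewrite mem_low_levels !inE /subspace_dist addv0 capv0 dimv0 subn0 ltnS.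
case/orP => [->//|/andP[/eqP dA XA]].
by rewrite (addv_idPl XA) (capv_idPr XA) dA dX subn1 leqnn orbT.
Qed.

Lemma diam_dist (F : finFieldType) (n : nat) (Fam : {set {vspace 'rV[F]_n}}) m A B :
  (diam Fam <= m)%N -> A \in Fam -> B \in Fam -> (subspace_dist A B <= m)%N.
Proof.
move=> hm AF BF; apply: leq_trans hm; apply: leq_trans (leq_bigmax_cond _ AF).
exact: (leq_bigmax_cond (F := subspace_dist A)).
Qed.

(* Perp composed with itself is an automorphism of the subspace lattice, but need not be
   the identity as the form is not assumed reflexive; hence the new point X'. *)
Lemma perp_family_D_family (F : finFieldType) (n t : nat) (form : {biscalar 'rV[F]_n})
    (Fam : {set {vspace 'rV[F]_n}}) (X : {vspace 'rV[F]_n}) :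
  nondegenerate_form form -> \dim X = 1%N ->
  perp_family form Fam \subset D_family t X ->
  exists2 X', \dim X' = 1%N & Fam \subset perp_family form (D_family t X').
Proof.
move=> nd dX sF.
have dimK U : \dim (perp form (perp form U)) = \dim U.
  by rewrite !dim_perp // subKn // dim_le.
have [X1 X1E] := perp_surj nd X; have [X' X'E] := perp_surj nd X1.
exists X'; first by rewrite -dimK X'E X1E.
apply/subsetP => U UF; have [U' U'E] := perp_surj nd U.
apply/imsetP; exists U' => //; have := subsetP sF _ (imset_f _ UF).
have DE W Z : (W \in D_family t Z) = (W \in low_levels F n t.+1) ||
    ((\dim W == t.+1) && (Z <= W)%VS) by rewrite !inE.
by rewrite !DE !mem_low_levels -U'E dimK -X1E -X'E !perp_sub.
Qed.

Theorem theorem1p4 (F : finFieldType) (n t : nat)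
    (form : {biscalar 'rV[F]_n}) (star : variant)
    (Fam : {set {vspace 'rV[F]_n}})
    (ht : (2 <= t)%N) (hn : (5 * t + 3 <= n)%N)
    (hform : nondegenerate_form form)
    (hdiam : (diam Fam <= 2 * t + 1)%N)
    (hA : star = VariantA ->
       forall X : {vspace 'rV[F]_n}, X \in grassmannian F n 1 ->
         ~ (Fam \subset D_family t X) /\
         ~ (Fam \subset perp_family form (D_family t X)))
    (hB : star = VariantB ->
       forall X Y : {vspace 'rV[F]_n}, subspace_dist X Y = 1%N ->
         ~ (Fam \subset ball X t :|: ball Y t)) :
  #|Fam|%:R <= stability_bound #|F| n t /\
  (#|Fam|%:R = stability_bound #|F| n t <->
     (exists X Y : {vspace 'rV[F]_n},
        [/\ X \in grassmannian F n 1, Y \in grassmannian F n (t + 1),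
            ~ (X <= Y)%VS &
            Fam = K_family (t + 1) X Y \/
            perp_family form Fam = K_family (t + 1) X Y])
     \/
     (t = 2%N /\
      exists Y : {vspace 'rV[F]_n},
        Y \in grassmannian F n 3 /\
        (Fam = Kstar_family Y \/ perp_family form Fam = Kstar_family Y))).
Proof.
have dist A B := diam_dist hdiam (A := A) (B := B).
(* Both variants reduce to this. In variant B, [D_family t X] lies in the balls around 0 and X,
   whose centres are at distance 1, and [perp] is an isometry. *)
have noD (X : {vspace 'rV[F]_n}) : \dim X = 1%N ->
    ~~ (Fam \subset D_family t X) /\ ~~ (Fam \subset perp_family form (D_family t X)).
  case: star hA hB => [/(_ erefl) hA _|_ /(_ erefl) hB] dX.
    have [|/negP h1 /negP h2] := hA X; first by rewrite inE dX.
    by split.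
  have d1 : subspace_dist 0 X = 1%N.
    by rewrite /subspace_dist add0v cap0v dX dimv0.
  split; apply/negP => sF.
    exact: hB d1 (subset_trans sF (D_family_balls t dX)).
  apply: (hB (perp form 0) (perp form X)); first by rewrite subspace_dist_perp.
  apply: (subset_trans sF); apply/subsetP => _ /imsetP[A AD ->].
  have := subsetP (D_family_balls t dX) _ AD.
  by rewrite !inE !subspace_dist_perp.
have n4 : (4 <= n)%N by nat_lia.
have [e|[A1 A1F]] := set_0Vmem Fam.
  have [|X _ dX] := @exists_dim F n fullv 1; first by rewrite dim_full; nat_lia.
  by have [] := noD X dX; rewrite e sub0set.
have H : #|Fam|%:R <= stability_bound #|F| n t /\
  (#|Fam|%:R = stability_bound #|F| n t ->
   exists2 Fam', Fam = Fam' \/ perp_family form Fam = Fam' &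
     (exists X Y, [/\ \dim X = 1%N, \dim Y = (t + 1)%N, ~~ (X <= Y)%VS &
                      Fam' = K_family (t + 1) X Y]) \/
     (t = 2%N /\ exists2 Y, \dim Y = 3%N & Fam' = Kstar_family Y)).
  have [Amin minF minP] := arg_minnP (fun B : {vspace 'rV[F]_n} => \dim B) A1F.
  have [Amax maxF maxP] := arg_maxnP (fun B : {vspace 'rV[F]_n} => \dim B) A1F.
  have [le|lt] := leqP (\dim Amin + \dim Amax) n.
    have [||le1 eq1] := one_sided_bound ht hn hform dist.
    - by move=> X dX; have [] := noD X dX.
    - exists Amin => // B BF; split; first exact: minP.
      by apply: leq_trans le; rewrite leq_add2l; exact: maxP.
    by split=> // /eq1 ?; exists Fam; [left|].
  (* When the extreme dimensions sum to more than n, those of the perp family sum to less than n,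
     with minimum attained at the perp of [Amax]. *)
  rewrite -(card_perp_family hform).
  have [|||le1 eq1] := @one_sided_bound F n t form ht hn hform (perp_family form Fam).
  - move=> _ _ /imsetP[A AF ->] /imsetP[B BF ->].
    by rewrite subspace_dist_perp // dist.
  - move=> X dX; apply/negP => /(perp_family_D_family hform dX)[X' dX' sF].
    by have [_] := noD X' dX'; rewrite sF.
  - exists (perp form Amax); first exact: imset_f.
    move=> _ /imsetP[B BF ->]; rewrite !dim_perp //.
    have leB : (\dim B <= \dim Amax)%N := maxP _ BF.
    have := minP _ BF; have := dim_le Amax; have := dim_le B.
    by nat_lia.
  by split=> // /eq1 ?; exists (perp_family form Fam); [right|].
have cardE Fam' : Fam = Fam' \/ perp_family form Fam = Fam' -> #|Fam| = #|Fam'|.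
  by case=> <- //; rewrite card_perp_family.
have [le eq] := H; split=> //; split.
  move=> /eq[Fam' FE [[X [Y [dX dY XY KE]]]|[t2 [Y dY KE]]]].
    left; exists X, Y; rewrite !inE dX dY !eqxx -KE; split=> //.
    exact/negP.
  by right; split=> //; exists Y; rewrite !inE dY -KE.
case=> [[X [Y [dX dY XY FE]]]|[t2 [Y [dY FE]]]]; rewrite (cardE _ FE).
  move: dX dY; rewrite !inE => /eqP dX /eqP dY.
  by apply: card_K_family => //; exact/negP.
by move: dY; rewrite inE => /eqP dY; rewrite t2; exact: card_Kstar_family.
Qed.
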